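(* Let $D$ be the twisted knot diagram $3_{82}$, i.e. the oriented twisted knot diagram with three classical crossings $c_1,c_2,c_3$ and three bars which, when traversed once along its orientation, yields the cyclic sequence (virtual crossings omitted) $$|\;U c_1\;\;U c_3\;\;|\;\;U c_2\;\;O c_1\;\;|\;\;O c_2\;\;O c_3 ,$$ where $O$ and $U$ denote over- and under-passages and $|$ denotes a bar, with $\operatorname{sgn}(c_1)=\operatorname{sgn}(c_2)=+1$ and $\operatorname{sgn}(c_3)=-1$. Then $D$ is not equivalent to the trivial non-orientable curve, i.e. to the crossingless closed curve with exactly one bar.
   Context: Twisted diagrams. A twisted link diagram is a generic immersion of circles in the plane in which every double point is either a classical crossing (with over/under information) or a virtual crossing, together with finitely many bars (short transverse marks) placed on edges away from the crossings. A twisted knot diagram has one circle. Two diagrams are equivalent if they are related by planar isotopy and a finite sequence of: the classical Reidemeister moves RI, RII, RIII; the virtual Reidemeister moves VR1, VR2, VR3 (the analogous moves with all crossings virtual); the semi-virtual move SV (a strand having two virtual crossings is moved across a classical crossing); and the twisted moves TI (a bar slides along its strand through a virtual crossing), TII (two bars adjacent on the same edge are cancelled or created), TIII (a classical crossing with a bar on each of its four legs is replaced by the configuration in which the two strands cross virtually, then classically, then virtually, with no bars, joining the same pairs of endpoints, where the formerly over strand is now the under strand at the classical crossing and the sign of the crossing is unchanged). Sign. $\operatorname{sgn}(c)=+1$ if the under-strand direction is obtained from the over-strand direction by a counterclockwise rotation by an angle less than $\pi$, and $-1$ otherwise. All diagrams with the same cyclic sequence of over/under passages and bars and the same crossing signs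 are equivalent (by virtual, semi-virtual and TI moves), so the sequence and signs in the claim determine the twisted knot. *)

(* Defs.v *)
From mathcomp Require Import all_boot all_order all_algebra.
From Stdlib Require Import Relations.
Import GRing.Theory Num.Theory.
Set Implicit Arguments.
Unset Strict Implicit.
Unset Printing Implicit Defensive.

(* A twisted link diagram in the plane is put in general position with respect
   to the height function and cut by horizontal lines into slices, each
   containing exactly one maximum, minimum, crossing or bar; all other strands
   of the slice are vertical.  A diagram is the list of its slices, read from
   bottom to top.  Every generic immersion with bars has this form after a
   small planar isotopy. *)
Inductive gen :=
  | Cup                (* local minimum *)
  | Cap                (* local maximum *)
  | Cross of bool      (* classical crossing; [true] when the over strand is the
                          one joining bottom left to top right *)
  | Virt               (* virtual crossing *)
  | Bar.

Definition nbot (g : gen) : nat :=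
  match g with Cup => 0 | Cap | Cross _ | Virt => 2 | Bar => 1 end.
Definition ntop (g : gen) : nat :=
  match g with Cap => 0 | Cup | Cross _ | Virt => 2 | Bar => 1 end.

(* [(g, i)] is the slice containing [g] with [i] vertical strands to its left;
   strands on a horizontal line are numbered from the left, starting at 0. *)
Definition slice : Type := gen * nat.

(* Number of strands above [w] when there are [n] strands below it; [None] if
   some slice needs more strands than are available. *)
Fixpoint strands (n : nat) (w : seq slice) : option nat :=
  if w is (g, i) :: w' then
    if i + nbot g <= n then strands (n - nbot g + ntop g) w' else None
  else Some n.

Definition closes_up (w : seq slice) : bool := strands 0 w == Some 0.

Definition diagram : Type := {w : seq slice | closes_up w}.

Definition slices (D : diagram) : seq slice := sval D.

(* Planar isotopy.  A generic planar isotopy changes the list of slices only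
   when two of the special points exchange heights, when a maximum and a minimum
   cancel or are created, or when a branch at a crossing, or the strand at
   a bar, becomes horizontal. *)
Inductive isotopy : seq slice -> seq slice -> Prop :=
  | Exchange g h i k :
      isotopy [:: (g, i); (h, i + ntop g + k)] [:: (h, i + nbot g + k); (g, i)]
  | ZigzagL i : isotopy [:: (Cup, i); (Cap, i.+1)] [::]
  | ZigzagR i : isotopy [:: (Cup, i.+1); (Cap, i)] [::]
  | CrossCap o i :
      isotopy [:: (Cross o, i); (Cap, i.+1)] [:: (Cross (~~ o), i.+1); (Cap, i)]
  | CrossCup o i :
      isotopy [:: (Cup, i.+1); (Cross o, i)] [:: (Cup, i); (Cross (~~ o), i.+1)]
  | VirtCap i : isotopy [:: (Virt, i); (Cap, i.+1)] [:: (Virt, i.+1); (Cap, i)]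
  | VirtCup i : isotopy [:: (Cup, i.+1); (Virt, i)] [:: (Cup, i); (Virt, i.+1)]
  | BarCap i : isotopy [:: (Bar, i); (Cap, i)] [:: (Bar, i.+1); (Cap, i)]
  | BarCup i : isotopy [:: (Cup, i); (Bar, i)] [:: (Cup, i); (Bar, i.+1)].

(* One picture of each move, up to rotation (which is available through
   [isotopy]).  In [RIII] the strands starting at bottom positions i, i+1, i+2
   are A, B, C; A is over B iff [x], A is over C iff [y], B is over C iff [z],
   and the side condition says that these choices are not cyclic.  In [SV] the
   strand A is the one with two virtual crossings; the cases of B and C follow
   using [VR2]. In [TIII], the strand starting at bottom left joins bottom left
   to top right at the crossing on the left-hand side, but bottom right to top
   left at the one on the right-hand side, so the same [o] means that over and
   under are exchanged. *)
Inductive tmove : seq slice -> seq slice -> Prop :=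
  | RI o i : tmove [:: (Cross o, i); (Cap, i)] [:: (Cap, i)]
  | RII o i : tmove [:: (Cross o, i); (Cross (~~ o), i)] [::]
  | RIII x y z i : (y == x) || (y == z) ->
      tmove [:: (Cross x, i); (Cross y, i.+1); (Cross z, i)]
           [:: (Cross z, i.+1); (Cross y, i); (Cross x, i.+1)]
  | VR1 i : tmove [:: (Virt, i); (Cap, i)] [:: (Cap, i)]
  | VR2 i : tmove [:: (Virt, i); (Virt, i)] [::]
  | VR3 i : tmove [:: (Virt, i); (Virt, i.+1); (Virt, i)]
                 [:: (Virt, i.+1); (Virt, i); (Virt, i.+1)]
  | SV o i : tmove [:: (Virt, i); (Virt, i.+1); (Cross o, i)]
                  [:: (Cross o, i.+1); (Virt, i); (Virt, i.+1)]
  | TI i : tmove [:: (Bar, i); (Virt, i)] [:: (Virt, i); (Bar, i.+1)]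
  | TII i : tmove [:: (Bar, i); (Bar, i)] [::]
  | TIII o i :
      tmove [:: (Bar, i); (Bar, i.+1); (Cross o, i); (Bar, i); (Bar, i.+1)]
           [:: (Virt, i); (Cross o, i); (Virt, i)].

Definition related (D D' : diagram) : Prop :=
  exists p u v q, [/\ isotopy u v \/ tmove u v,
                      slices D = p ++ u ++ q & slices D' = p ++ v ++ q].

Definition equivalent : diagram -> diagram -> Prop :=
  clos_refl_sym_trans diagram related.

(* The crossingless closed curve with one bar. *)
Definition trivial_nonorientable_curve : diagram :=
  exist _ [:: (Cup, 0); (Bar, 0); (Cap, 0)] isT.

(* Traversing a diagram.  The points of [w] are the pairs [(k, p)], the p-th
   strand on the line between slices k-1 and k; a state [(up, (k, p))] is such
   a point with a direction of travel. *)
Definition point : Type := (nat * nat)%type.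
Definition state : Type := (bool * point)%type.

Definition points (w : seq slice) : seq point :=
  [seq (k, p) | k <- iota 0 (size w).+1,
                p <- iota 0 (odflt 0 (strands 0 (take k w)))].

(* Index of the slice about to be entered. *)
Definition slice_index (x : state) : nat :=
  let: (up, (k, _)) := x in if up then k else k.-1.

Definition next_slice (w : seq slice) (x : state) : slice :=
  nth (Bar, 0) w (slice_index x).

Definition nentry (g : gen) (up : bool) : nat := if up then nbot g else ntop g.
Definition nexit (g : gen) (up : bool) : nat := if up then ntop g else nbot g.

(* Whether the strand being followed takes part in [g] (and is not one of the
   vertical strands of the slice). *)
Definition involved (sl : slice) (up : bool) (p : nat) : bool :=
  sl.2 <= p < sl.2 + nentry sl.1 up.

Definition through (sl : slice) (up : bool) (p : nat) : bool * nat :=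
  let: (g, i) := sl in
  if involved sl up p then
    let other := if p == i then i.+1 else i in
    match g with
    | Cup | Cap => (~~ up, other)
    | Cross _ | Virt => (up, other)
    | Bar => (up, p)
    end
  else (up, if p < i then p else p - nentry g up + nexit g up).

Definition step (w : seq slice) (x : state) : state :=
  let: (up', p') := through (next_slice w x) x.1 x.2.2 in
  (up', (if up' then (slice_index x).+1 else slice_index x, p')).

(* [s] traverses [w] once, from a base point and in a direction given by the
   first state of [s]; such an [s] exists only if [w] has a single circle. *)
Definition traversal (w : seq slice) (s : seq state) : bool :=
  fcycle (step w) s && perm_eq [seq x.2 | x <- s] (points w).

(* [None] is a bar, [Some (b, c)] an over ([b = true]) or under passage of the
   classical crossing in slice number [c]. *)
Definition passage : Type := option (bool * nat).
Definition bar : passage := None.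
Definition Over (c : nat) : passage := Some (true, c).
Definition Under (c : nat) : passage := Some (false, c).

Definition passages (w : seq slice) (x : state) : seq passage :=
  let: (up, (_, p)) := x in
  let: (g, i) := next_slice w x in
  if involved (g, i) up p then
    match g with
    | Bar => [:: bar]
    | Cross o =>
        let bottom_left_to_top_right := (p == i) == up in
        [:: if bottom_left_to_top_right == o then Over (slice_index x)
            else Under (slice_index x)]
    | _ => [::]
    end
  else [::].

Definition code (w : seq slice) (s : seq state) : seq passage :=
  flatten [seq passages w x | x <- s].

(* The direction in which the state [x] runs through a crossing. *)
Definition direction (w : seq slice) (x : state) : int * int :=
  let: (up, (_, p)) := x in
  ((if p == (next_slice w x).2 then 1 else -1)%R, (if up then 1 else -1)%R).

Definition direction_at (w : seq slice) (s : seq state) (a : passage) :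
    int * int :=
  head (0%R, 0%R) [seq direction w x | x <- s & a \in passages w x].

(* The determinant of (over direction, under direction) is positive iff the
   latter is a counterclockwise rotation of the former by less than pi. *)
Definition sgn (w : seq slice) (s : seq state) (c : nat) : int :=
  let a := direction_at w s (Over c) in
  let b := direction_at w s (Under c) in
  Num.sg (a.1 * b.2 - a.2 * b.1)%R.

(* A diagram with the code and signs of [mainTheorem2] exists: the closure of
   a six-strand braid in which each passage has its own strand and the virtual
   crossings realise the permutation joining consecutive passages. *)
Definition example_slices : seq slice :=
  [:: (Cup, 0); (Cup, 1); (Cup, 2); (Cup, 3); (Cup, 4); (Cup, 5);
      (Cross true, 0); (Cross true, 2); (Cross false, 4);
      (Bar, 1); (Bar, 4); (Bar, 5);
      (Virt, 0); (Virt, 1); (Virt, 3); (Virt, 4); (Virt, 0); (Virt, 2);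
      (Virt, 3); (Virt, 1);
      (Cap, 5); (Cap, 4); (Cap, 3); (Cap, 2); (Cap, 1); (Cap, 0)].

Lemma example_exists : exists (D : diagram) (s : seq state) (c1 c2 c3 : nat),
  [/\ traversal (slices D) s,
      code (slices D) s = [:: bar; Under c1; Under c3; bar; Under c2; Over c1;
                              bar; Over c2; Over c3],
      sgn (slices D) s c1 = 1%R, sgn (slices D) s c2 = 1%R
    & sgn (slices D) s c3 = (-1)%R].
Proof.
exists (exist _ example_slices isT).
exists (traject (step example_slices) (true, (9, 4)) 240), 6, 7, 8.
by split; vm_compute.
Qed.

(* Main.v *)
Require Import Defs.
From mathcomp Require Import all_boot all_order all_algebra.
From mathcomp Require Import zify.
From Stdlib Require Import Relations NArith FunctionalExtensionality.
Import GRing.Theory Num.Theory.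
Set Implicit Arguments.
Unset Strict Implicit.
Unset Printing Implicit Defensive.

(** The invariant is a two-cable Kauffman bracket.  For A^2 = 2 the value
    -A^2 - A^-2 of a loop is 3 in F_11, so the bracket is a contraction of
    tensors on a 3-dimensional space V with an orthonormal basis, in which
    virtual crossings act as flips.  Double every strand and restrict the
    matrices V (x) V to the traceless ones: only even powers of A occur, a curl
    multiplies the result by A^8 = 5 or its inverse, which are fifth roots of
    unity, and a bar, where the two parallel strands cross virtually, acts as
    the transposition.  The fifth power of the contraction is therefore
    invariant under all moves.

    Only bars and classical crossings do more than carry a label along a strand,
    and the weight of a crossing depends on its sign and on the four labels read
    in the direction of travel.  So the contraction is a sum over the labels of
    the arcs between consecutive passages of the code.  It is 5 for the given
    code and signs, and 2, the trace of the transposition on the traceless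
    matrices, for the crossingless curve with one bar; in F_11 the fifth powers
    are 1 and -1. *)

(** * The labelled contraction *)

Definition labels : seq nat := iota 0 8.
Arguments labels : simpl never.

(* The label of the transposed basis matrix. *)
Definition dual (a : nat) : nat := nth 0 [:: 1; 0; 3; 2; 5; 4; 6; 7] a.

Definition entry (m : seq (seq N)) (i j : nat) : N := nth 0%num (nth [::] m i) j.

(* A basis of the traceless 3 x 3 matrices over F_11, orthonormal for
   [mat_dot]; the last two matrices are diag(2,4,-6) and diag(9,6,-15). *)
Definition basis_matrix (a : nat) : seq (seq N) :=
  nth [::] [:: [:: [:: 0; 1; 0]; [:: 0; 0; 0]; [:: 0; 0; 0]];
               [:: [:: 0; 0; 0]; [:: 1; 0; 0]; [:: 0; 0; 0]];
               [:: [:: 0; 0; 1]; [:: 0; 0; 0]; [:: 0; 0; 0]];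
               [:: [:: 0; 0; 0]; [:: 0; 0; 0]; [:: 1; 0; 0]];
               [:: [:: 0; 0; 0]; [:: 0; 0; 1]; [:: 0; 0; 0]];
               [:: [:: 0; 0; 0]; [:: 0; 0; 0]; [:: 0; 1; 0]];
               [:: [:: 2; 0; 0]; [:: 0; 4; 0]; [:: 0; 0; 5]];
               [:: [:: 9; 0; 0]; [:: 0; 6; 0]; [:: 0; 0; 7]]]%num a.

Definition sum3 (f : nat -> N) : N := (f 0 + f 1 + f 2)%num.

Definition mat_mul (m m' : seq (seq N)) : seq (seq N) :=
  [seq [seq sum3 (fun k => entry m i k * entry m' k j)%num | j <- iota 0 3]
     | i <- iota 0 3].

Definition mat_trace (m : seq (seq N)) : N := sum3 (fun i => entry m i i).

Definition mat_dot (m m' : seq (seq N)) : N :=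
  sum3 (fun i => sum3 (fun j => entry m i j * entry m' i j)%num).

(* The doubled crossing consists of four crossings.  Among the planar pairings
   in the expansion of its bracket only three do not vanish on traceless
   matrices: no strands joined, the two inner strands joined below and above,
   and all strands joined by nested arcs.  Their coefficients, for A^2 = 2 or
   its inverse according to [o], are x, 8 and z. *)
Definition crossing_weight (o : bool) (a b c d : nat) : N :=
  let: (x, z) := if o then (4, 3)%num else (3, 4)%num in
  let: (ma, mb) := (basis_matrix a, basis_matrix b) in
  let: (mc, md) := (basis_matrix c, basis_matrix d) in
  N.modulo (x * mat_dot ma mc * mat_dot mb md
            + 8 * mat_dot (mat_mul ma mb) (mat_mul mc md)
            + z * mat_trace (mat_mul ma mb) * mat_trace (mat_mul mc md))%num 11.

(** Evaluated once and for all, with zero weights removed, so that later computations look up only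
    the nonzero terms. *)
Definition crossing_table : seq (seq (seq (seq (N * seq nat)))) :=
  Eval vm_compute in
  [seq [seq [seq [seq x <- [seq (crossing_weight o a b c d, [:: c; d])
                             | c <- labels, d <- labels] | x.1 != 0%num]
             | b <- labels] | a <- labels] | o <- [:: false; true]].

(* The image of a basis vector, as the list of its terms. *)
Definition outs (g : gen) (m : seq nat) : seq (N * seq nat) :=
  match g, m with
  | Cup, [::] => [seq (1%num, [:: a; dual a]) | a <- labels]
  | Cap, [:: a; b] => if b == dual a then [:: (1%num, [::])] else [::]
  | Virt, [:: a; b] => [:: (1%num, [:: b; a])]
  | Bar, [:: a] => [:: (1%num, [:: dual a])]
  | Cross o, [:: a; b] =>
      nth [::] (nth [::] (nth [::] crossing_table o) a) b
  | _, _ => [::]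
  end.

Definition act (sl : slice) (s : seq nat) : seq (N * seq nat) :=
  [seq (x.1, take sl.2 s ++ x.2 ++ drop (sl.2 + nbot sl.1) s)
     | x <- outs sl.1 (take (nbot sl.1) (drop sl.2 s))].

Definition toF (n : N) : 'F_11 := ((N.to_nat n)%:R)%R.

(** The contraction is carried out from the bottom line upwards, as a linear functional on the basis
    tensors [s]. A closed diagram ends with no strands, so [ev w [::]] is its full contraction. *)
Fixpoint ev (w : seq slice) (s : seq nat) : 'F_11 :=
  if w is sl :: w' then (\sum_(x <- act sl s) toF x.1 * ev w' x.2)%R else 1%R.

Fixpoint all_seqs (n : nat) : seq (seq nat) :=
  if n is n'.+1 then [seq a :: s | a <- labels, s <- all_seqs n'] else [:: [::]].

Arguments all_seqs : simpl never.

Lemma all_seqsS n :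
  all_seqs n.+1 = [seq a :: s | a <- labels, s <- all_seqs n].
Proof. by []. Qed.

Lemma mem_all_seqs n s :
  (s \in all_seqs n) = (size s == n) && all (fun a => a < 8) s.
Proof.
elim: n s => [|n IH] s; first by rewrite inE; case: s.
rewrite all_seqsS; apply/allpairsP/idP => [[[b t] /= [hb ht ->]]|].
  by rewrite /= eqSS; move: hb ht; rewrite mem_iota IH /= => hb /andP[-> ->]; rewrite andbT.
case: s => [|a s] //; rewrite /= eqSS andbCA -IH => /andP[ha hs].
by exists (a, s); split => //=; rewrite mem_iota.
Qed.

Lemma uniq_all_seqs n : uniq (all_seqs n).
Proof.
elim: n => // n IH; rewrite all_seqsS; apply: allpairs_uniq => //.
by move=> [a s] [b t] _ _ /= [-> ->].
Qed.

Lemma toF0 : toF 0 = 0%R. Proof. by []. Qed.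

Lemma toF1 : toF 1 = 1%R. Proof. by []. Qed.

Lemma toFD a b : toF (a + b) = (toF a + toF b)%R.
Proof. by rewrite /toF N2Nat.inj_add natrD. Qed.

Lemma toFM a b : toF (a * b) = (toF a * toF b)%R.
Proof. by rewrite /toF N2Nat.inj_mul natrM. Qed.

Lemma toF_mod a : toF (N.modulo a 11) = toF a.
Proof.
rewrite [in RHS](N.div_mod' a 11) toFD toFM.
have -> : toF 11 = 0%R by apply/eqP.
by rewrite mul0r add0r.
Qed.

(** * Computing with formal combinations modulo 11 *)

Definition comb := seq (N * seq nat).

Definition coef_sum (l : comb) : N := foldr (fun x n => N.modulo (x.1 + n) 11) 0%num l.

Definition scale (c : N) (l : comb) : comb := [seq ((c * x.1)%num, x.2) | x <- l].

Definition coeff (l : comb) (t : seq nat) : N := coef_sum [seq x <- l | x.2 == t].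

(** The comparison used inside [vm_compute]: the [if] in [same_seq] stops at the first difference,
    whereas [&&] would evaluate both sides under call by value. *)
Fixpoint same_nat (a b : nat) : bool :=
  match a, b with
  | 0, 0 => true
  | a'.+1, b'.+1 => same_nat a' b'
  | _, _ => false
  end.

Fixpoint same_seq (s t : seq nat) : bool :=
  match s, t with
  | [::], [::] => true
  | a :: s', b :: t' => if same_nat a b then same_seq s' t' else false
  | _, _ => false
  end.

Fixpoint insert (c : N) (t : seq nat) (l : comb) : comb :=
  if l is y :: l' then
    if same_seq y.2 t then (N.modulo (c + y.1) 11, t) :: l'
    else y :: insert c t l'
  else [:: (N.modulo c 11, t)].

Definition collect (l : comb) : comb :=
  [seq x <- foldr (fun x => insert x.1 x.2) [::] l
     | if x.1 is 0%num then false else true].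

Lemma same_seqP s t : same_seq s t -> s = t.
Proof.
have same_natP a b : same_nat a b -> a = b.
  by elim: a b => [|a IH] [|b] //= /IH ->.
elim: s t => [|a s IH] [|b t] //=.
by case: ifP => // /same_natP -> /IH ->.
Qed.

Definition linext (l : comb) (F : seq nat -> 'F_11) : 'F_11 :=
  (\sum_(x <- l) toF x.1 * F x.2)%R.

Lemma toF_coef_sum l : toF (coef_sum l) = (\sum_(x <- l) toF x.1)%R.
Proof.
elim: l => [|x l IH]; first by rewrite big_nil.
by rewrite big_cons /= toF_mod toFD IH.
Qed.

(** Inserting a sum over [T] that picks out the sequence of each term, and exchanging the two sums,
    groups equal sequences together. This is what turns the recursive evaluation into a sum over
    labels. *)
Lemma sum_by_value (l : comb) (T : seq (seq nat)) F : uniq T ->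
  {subset [seq x.2 | x <- l] <= T} ->
  linext l F = (\sum_(t <- T) toF (coeff l t) * F t)%R.
Proof.
move=> uT sub; rewrite /linext.
transitivity (\sum_(x <- l) \sum_(t <- T | x.2 == t) toF x.1 * F t)%R.
  rewrite big_seq [RHS]big_seq; apply: eq_bigr => x xl.
  rewrite (eq_bigl (pred1 x.2)); last by move=> t; rewrite eq_sym.
  by rewrite -big_filter filter_pred1_uniq ?big_seq1 // sub // map_f.
rewrite (exchange_big_dep xpredT) //=; apply: eq_bigr => t _.
by rewrite /coeff toF_coef_sum big_filter mulr_suml.
Qed.

Lemma linext_scale c l F : linext (scale c l) F = (toF c * linext l F)%R.
Proof.
rewrite /linext big_map mulr_sumr; apply: eq_bigr => x _.
by rewrite toFM mulrA.
Qed.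

Lemma linext_insert c t l F : linext (insert c t l) F = (toF c * F t + linext l F)%R.
Proof.
elim: l => [|y l IH] /=; first by rewrite /linext big_seq1 big_nil toF_mod addr0.
case: ifP => [/same_seqP <-|_]; rewrite /linext !big_cons /= -/(linext _ _).
  by rewrite toF_mod toFD mulrDl addrA.
by rewrite IH addrCA.
Qed.

Lemma linext_collect l F : linext (collect l) F = linext l F.
Proof.
rewrite /linext /collect big_filter big_mkcond /=.
transitivity (linext (foldr (fun x => insert x.1 x.2) [::] l) F).
  by apply: eq_bigr => -[[|c] t] _ //=; rewrite toF0 mul0r.
elim: l => [|x l IH] //=; rewrite linext_insert IH.
by rewrite /linext big_cons.
Qed.

(** The computable counterpart of [ev], for words that need not close up: the image of a basis
    tensor is expanded in full. Collecting after every slice keeps the intermediate lists short. *)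
Fixpoint run (w : seq slice) (s : seq nat) : comb :=
  if w is sl :: w' then
    collect (flatten [seq scale x.1 (run w' x.2) | x <- act sl s])
  else [:: (1%num, s)].

Lemma linext_cat l l' F : linext (l ++ l') F = (linext l F + linext l' F)%R.
Proof. exact: big_cat. Qed.

(* 10 is -1 in F_11. *)
Definition eq_comb (l l' : comb) : bool := nilp (collect (l ++ scale 10 l')).

Lemma eq_combP l l' F : eq_comb l l' -> linext l F = linext l' F.
Proof.
move=> /nilP h; apply/eqP; rewrite -subr_eq0; apply/eqP.
transitivity (linext (l ++ scale 10 l') F).
  have m1 : (toF 10 = -1)%R by apply/eqP.
  by rewrite linext_cat linext_scale m1 mulN1r.
by rewrite -linext_collect h /linext big_nil.
Qed.

(** * Locality of the action *)

Definition shift (i : nat) (u : seq slice) : seq slice :=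
  [seq (x.1, i + x.2) | x <- u].

Lemma linext_flatten (I : Type) (r : seq I) (L : I -> comb) F :
  linext (flatten [seq L x | x <- r]) F = (\sum_(x <- r) linext (L x) F)%R.
Proof.
elim: r => [|x r IH]; first by rewrite /linext !big_nil.
by rewrite big_cons /= linext_cat IH.
Qed.

Definition valid (n : nat) (s : seq nat) : bool := s \in all_seqs n.

Lemma valid_cat n m s t : valid n s -> valid m t -> valid (n + m) (s ++ t).
Proof.
rewrite /valid !mem_all_seqs size_cat all_cat.
by move=> /andP[/eqP-> ->] /andP[/eqP-> ->]; rewrite eqxx.
Qed.

Lemma valid_take n i s : i <= n -> valid n s -> valid i (take i s).
Proof.
rewrite /valid !mem_all_seqs => le /andP[/eqP sz al].
rewrite size_takel ?sz // eqxx /=.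
by move: al; rewrite -{1}(cat_take_drop i s) all_cat => /andP[].
Qed.

Lemma valid_drop n i s : valid n s -> valid (n - i) (drop i s).
Proof.
rewrite /valid !mem_all_seqs => /andP[/eqP sz al].
rewrite size_drop sz eqxx /=.
by move: al; rewrite -{1}(cat_take_drop i s) all_cat => /andP[].
Qed.

Lemma valid_outs g m x : valid (nbot g) m -> x \in outs g m -> valid (ntop g) x.2.
Proof.
have hg : all (fun m => all (fun x => valid (ntop g) x.2) (outs g m))
   (all_seqs (nbot g)) by case: g {x m} => [||[]||]; vm_compute.
by move=> hm hx; exact: (allP (allP hg m hm)).
Qed.

Lemma valid_act n sl s x : sl.2 + nbot sl.1 <= n -> valid n s ->
  x \in act sl s -> valid (n - nbot sl.1 + ntop sl.1) x.2.
Proof.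
case: sl => g i /= le vs /mapP[y /valid_outs vy ->] /=.
have -> : n - nbot g + ntop g = i + (ntop g + (n - (i + nbot g))) by lia.
apply: valid_cat; first by apply: valid_take vs; lia.
apply: valid_cat; last exact: valid_drop.
apply: vy; apply: (@valid_take (n - i)); rewrite /=; [lia | exact: valid_drop].
Qed.

(** A slice touches only its own strands, so the labels [pre] to the left and [post] to the right
    are carried along. Everything that reduces moves in large diagrams to small computations rests
    on this. *)
Lemma act_pad i g j pre m post : size pre = i -> j + nbot g <= size m ->
  act (g, i + j) (pre ++ m ++ post) =
  [seq (x.1, pre ++ x.2 ++ post) | x <- act (g, j) m].
Proof.
move=> <- le; rewrite /act /= -map_comp.
have e1 : take (size pre + j) (pre ++ m ++ post) = pre ++ take j m.
  rewrite take_cat ltnNge leq_addr /= addKn takel_cat //.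
  exact: leq_trans (leq_addr _ _) le.
have e2 : drop (size pre + j + nbot g) (pre ++ m ++ post) =
    drop (j + nbot g) m ++ post.
  rewrite -addnA drop_cat ltnNge leq_addr /= addKn drop_cat.
  case: ltnP => // lt; have -> : j + nbot g - size m = 0 by lia.
  by rewrite drop0 [drop _ m]drop_oversize.
have e3 : take (nbot g) (drop (size pre + j) (pre ++ m ++ post)) =
    take (nbot g) (drop j m).
  rewrite drop_cat ltnNge leq_addr /= addKn drop_cat.
  case: ltnP => lt; first by rewrite takel_cat // size_drop; lia.
  by have -> : nbot g = 0 by [lia]; rewrite !take0.
by rewrite e1 e2 e3; apply: eq_map => x /=; rewrite -!catA.
Qed.

(** The word [u] can be expanded on its own strands first, and the rest [q] evaluated on each
    resulting term: the bystanders [pre] and [post] never interact with [u]. *)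
Lemma ev_shift i u q pre m post : size pre = i -> valid (size m) m ->
  strands (size m) u -> 
  ev (shift i u ++ q) (pre ++ m ++ post) =
  linext (run u m) (fun t => ev q (pre ++ t ++ post)).
Proof.
move=> si; elim: u m => [|[g j] u IH] m vm /=.
  by rewrite /linext big_seq1 toF1 mul1r.
case: ifP => // le st.
rewrite act_pad // big_map linext_collect linext_flatten big_seq [RHS]big_seq.
apply: eq_bigr => x hx; have vx := valid_act (sl := (g, j)) le vm hx.
have sz : size x.2 = size m - nbot g + ntop g.
  by move: vx; rewrite /valid mem_all_seqs => /andP[/eqP].
by rewrite linext_scale IH // sz.
Qed.

(** Linearity: the common prefix [p] produces the same combination on both sides, and the scalar [c]
    factors out of every term. *)
Lemma ev_cat c n n' p x y : strands n p = Some n' ->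
  (forall s, valid n' s -> ev x s = c * ev y s)%R ->
  forall s, valid n s -> (ev (p ++ x) s = c * ev (p ++ y) s)%R.
Proof.
move=> + h; elim: p n => [|[g i] p IH] n /=; first by move=> [->].
case: ifP => // le st s vs.
rewrite big_seq [in RHS]big_seq mulr_sumr; apply: eq_bigr => t ht.
rewrite (IH _ st); last exact: (valid_act (sl := (g, i)) le vs ht).
by rewrite mulrCA.
Qed.

Definition local_check (c : N) (k : nat) (u v : seq slice) : bool :=
  strands k u && strands k v &&
  all (fun m => eq_comb (run u m) (scale c (run v m))) (all_seqs k).

Lemma local_move c k u v : local_check c k u v ->
  forall i q n, i + k <= n -> forall s, valid n s ->
  (ev (shift i u ++ q) s = toF c * ev (shift i v ++ q) s)%R.
Proof.
move=> /andP[/andP[su sv] /allP h] i q n le s vs.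
rewrite -(cat_take_drop i s) -(cat_take_drop k (drop i s)) drop_drop.
set pre := take i s; set m := take k _; set post := drop _ s.
have vm : valid k m by apply: (@valid_take (n - i)); [lia | exact: valid_drop].
have sm : size m = k by move: vm; rewrite /valid mem_all_seqs => /andP[/eqP].
have spre : size pre = i.
  rewrite size_takel //.
  by move: vs; rewrite /valid mem_all_seqs => /andP[/eqP-> _]; lia.
rewrite !ev_shift ?sm // (eq_combP _ (h _ vm)) linext_scale //.
Qed.

(** Operators on disjoint groups of strands commute. The gap [k] is arbitrary, so no finite check
    applies; instead [s] is cut into five blocks and the resulting double sum is exchanged. *)
Lemma exchange_move g h i k q n s :
  i + nbot g + k + nbot h <= n -> valid n s ->
  ev [:: (g, i), (h, i + ntop g + k) & q] s =
  ev [:: (h, i + nbot g + k), (g, i) & q] s.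
Proof.
move=> le vs.
have sz : size s = n by move: vs; rewrite /valid mem_all_seqs => /andP[/eqP].
set pre := take i s; set m1 := take (nbot g) (drop i s).
set mid := take k (drop (i + nbot g) s).
set m2 := take (nbot h) (drop (i + nbot g + k) s).
set post := drop (i + nbot g + k + nbot h) s.
have es : s = pre ++ m1 ++ mid ++ m2 ++ post.
  rewrite -{1}(cat_take_drop i s) -{1}(cat_take_drop (nbot g) (drop i s)) drop_drop.
  rewrite addnC -{1}(cat_take_drop k (drop (i + nbot g) s)) drop_drop.
  rewrite [k + _]addnC -{1}(cat_take_drop (nbot h) (drop (i + nbot g + k) s)) drop_drop.
  by rewrite [nbot h + _]addnC.
have [s0 s1 s2 s3] : [/\ size pre = i, size m1 = nbot g, size mid = k & size m2 = nbot h].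
  by split; rewrite size_takel // ?size_drop ?sz; lia.
have v1 : valid (nbot g) m1.
  by apply: (@valid_take (n - i)); [lia | exact: valid_drop].
have v2 : valid (nbot h) m2.
  by apply: (@valid_take (n - (i + nbot g + k))); [lia | exact: valid_drop].
have act0 g' m : size m = nbot g' -> act (g', 0) m = outs g' m.
  move=> sm; rewrite /act /= take0 drop0 add0n take_oversize ?sm //.
  rewrite drop_oversize ?sm // -[RHS]map_id; apply: eq_map => -[x y] /=.
  by rewrite cats0.
have actE g' j p m r : size p = j -> size m = nbot g' ->
    act (g', j) (p ++ m ++ r) = [seq (x.1, p ++ x.2 ++ r) | x <- outs g' m].
  by move=> sp sm; rewrite -{1}[j]addn0 act_pad ?sm // act0.
have so g' m x : valid (nbot g') m -> x \in outs g' m -> size x.2 = ntop g'.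
  by move=> vm /(valid_outs vm); rewrite /valid mem_all_seqs => /andP[/eqP].
rewrite /= es actE // big_map big_seq.
(* Membership is kept as a condition because it fixes the length of [x.2], and hence the position at
   which [h] acts after [g]. *)
transitivity (\sum_(x <- outs g m1 | x \in outs g m1) \sum_(y <- outs h m2 | y \in outs h m2)
   toF x.1 * (toF y.1 * ev q (pre ++ x.2 ++ mid ++ y.2 ++ post)))%R.
  apply: eq_bigr => x hx /=.
  have -> : pre ++ x.2 ++ mid ++ m2 ++ post = (pre ++ x.2 ++ mid) ++ m2 ++ post.
    by rewrite -!catA.
  rewrite actE //; last by rewrite !size_cat (so _ _ _ v1 hx); lia.
  rewrite big_map mulr_sumr big_seq; apply: eq_bigr => y hy /=.
  by rewrite -!catA.
have -> : pre ++ m1 ++ mid ++ m2 ++ post = (pre ++ m1 ++ mid) ++ m2 ++ post.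
  by rewrite -!catA.
rewrite exchange_big actE //=; last by rewrite !size_cat; lia.
rewrite big_map [RHS]big_seq; apply: eq_bigr => y hy /=.
rewrite -!catA actE // big_map mulr_sumr [RHS]big_seq; apply: eq_bigr => x hx /=.
by rewrite mulrCA.
Qed.

Definition yang_baxter_check (t : bool * bool * bool) : bool :=
  let: (x, y, z) := t in
  local_check 1 3 [:: (Cross x, 0); (Cross y, 1); (Cross z, 0)]
                  [:: (Cross z, 1); (Cross y, 0); (Cross x, 1)].

(** Of the eight patterns, [(true, false, true)] and [(false, true, false)] are the cyclic ones
    ruled out in [RIII]; the other six are verified by computation on three strands. *)
Lemma yang_baxter_checked :
  all yang_baxter_check
    [:: (true, true, true); (true, true, false); (true, false, false);
        (false, true, true); (false, false, true); (false, false, false)].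
Proof. by vm_compute. Qed.

Lemma yang_baxter x y z : (y == x) || (y == z) -> yang_baxter_check (x, y, z).
Proof.
move=> h; apply: (allP yang_baxter_checked (x, y, z)).
by move: h; case: x; case: y; case: z.
Qed.

(** * Invariance under the moves *)

Definition related_by (c : 'F_11) (n : nat) (x y : seq slice) : Prop :=
  forall s, valid n s -> ev x s = (c * ev y s)%R.

Lemma local_related c k u v i q n : local_check c k u v ->
  i + k <= n -> related_by (toF c) n (shift i u ++ q) (shift i v ++ q).
Proof. by move=> h le s vs; apply: local_move h _ _ _ le _ vs. Qed.

(** Each clause other than [Exchange] is a translate of a word on at most three strands and is
    settled on basis tensors. The strand counts supply the room needed at position [i]. *)
Lemma isotopy_related u v q n : isotopy u v ->
  strands n (u ++ q) -> strands n (v ++ q) -> related_by 1%R n (u ++ q) (v ++ q).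
Proof.
rewrite -toF1; case => {u v} [g h i k|i|i|o i|o i|i|i|i|i] /=.
- case: ifP => // le1; case: ifP => // le2 _ _ s vs.
  rewrite toF1 mul1r; apply: exchange_move vs; lia.
- case: ifP => // le1; case: ifP => // le _ _.
  have := @local_related 1 1 [:: (Cup, 0); (Cap, 1)] [::] i q n.
  by rewrite /= addn0 addn1; apply; [vm_compute | lia].
- case: ifP => // le1; case: ifP => // le _ _.
  have := @local_related 1 1 [:: (Cup, 1); (Cap, 0)] [::] i q n.
  by rewrite /= addn0 addn1; apply; [vm_compute | lia].
- case: ifP => // le1; case: ifP => // le _ _.
  have := @local_related 1 3 [:: (Cross o, 0); (Cap, 1)]
                             [:: (Cross (~~ o), 1); (Cap, 0)] i q n.
  by rewrite /= addn0 addn1; apply; [case: o; vm_compute | lia].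
- case: ifP => // le1; case: ifP => // le _ _.
  have := @local_related 1 1 [:: (Cup, 1); (Cross o, 0)]
                             [:: (Cup, 0); (Cross (~~ o), 1)] i q n.
  by rewrite /= addn0 addn1; apply; [case: o; vm_compute | lia].
- case: ifP => // le1; case: ifP => // le _ _.
  have := @local_related 1 3 [:: (Virt, 0); (Cap, 1)]
                             [:: (Virt, 1); (Cap, 0)] i q n.
  by rewrite /= addn0 addn1; apply; [vm_compute | lia].
- case: ifP => // le1; case: ifP => // le _ _.
  have := @local_related 1 1 [:: (Cup, 1); (Virt, 0)]
                             [:: (Cup, 0); (Virt, 1)] i q n.
  by rewrite /= addn0 addn1; apply; [vm_compute | lia].
- case: ifP => // le1; case: ifP => // le _ _.
  have := @local_related 1 2 [:: (Bar, 0); (Cap, 0)]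
                             [:: (Bar, 1); (Cap, 0)] i q n.
  by rewrite /= addn0 addn1; apply; [vm_compute | lia].
- case: ifP => // le1; case: ifP => // le _ _.
  have := @local_related 1 0 [:: (Cup, 0); (Bar, 0)]
                             [:: (Cup, 0); (Bar, 1)] i q n.
  by rewrite /= addn0 addn1; apply; [vm_compute | lia].
Qed.

(* The factor of a curl: A^8 = 5 or its inverse 9. *)
Definition twist (u : seq slice) : N :=
  match u with
  | [:: (Cross o, _); (Cap, _)] => if o then 9%num else 5%num
  | _ => 1%num
  end.

Lemma tmove_related u v q n : tmove u v ->
  strands n (u ++ q) -> strands n (v ++ q) ->
  related_by (toF (twist u)) n (u ++ q) (v ++ q).
Proof.
case => {u v} [o i|o i|x y z i hxyz|i|i|i|o i|i|i|o i] /=.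
- case: ifP => // le1; case: ifP => // le _ _.
  have := @local_related (if o then 9 else 5)%num 2 [:: (Cross o, 0); (Cap, 0)]
     [:: (Cap, 0)] i q n.
  by rewrite /= addn0; apply; [case: (o); vm_compute | lia].
- case: ifP => // le1; case: ifP => // le _ _.
  have := @local_related 1 2 [:: (Cross o, 0); (Cross (~~ o), 0)] [::] i q n.
  by rewrite /= addn0; apply; [case: (o); vm_compute | lia].
- case: ifP => // le1; case: ifP => // le _ _.
  have := @local_related 1 3 [:: (Cross x, 0); (Cross y, 1); (Cross z, 0)]
     [:: (Cross z, 1); (Cross y, 0); (Cross x, 1)] i q n.
  rewrite /= addn0 addn1; apply; last lia.
  exact: yang_baxter.
- case: ifP => // le1; case: ifP => // le _ _.
  have := @local_related 1 2 [:: (Virt, 0); (Cap, 0)] [:: (Cap, 0)] i q n.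
  by rewrite /= addn0; apply; [vm_compute | lia].
- case: ifP => // le1; case: ifP => // le _ _.
  have := @local_related 1 2 [:: (Virt, 0); (Virt, 0)] [::] i q n.
  by rewrite /= addn0; apply; [vm_compute | lia].
- case: ifP => // le1; case: ifP => // le _ _.
  have := @local_related 1 3 [:: (Virt, 0); (Virt, 1); (Virt, 0)]
     [:: (Virt, 1); (Virt, 0); (Virt, 1)] i q n.
  by rewrite /= addn0 addn1; apply; [vm_compute | lia].
- case: ifP => // le1; case: ifP => // le _ _.
  have := @local_related 1 3 [:: (Virt, 0); (Virt, 1); (Cross o, 0)]
     [:: (Cross o, 1); (Virt, 0); (Virt, 1)] i q n.
  by rewrite /= addn0 addn1; apply; [case: (o); vm_compute | lia].
- case: ifP => // le1; case: ifP => // le _ _.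
  have := @local_related 1 2 [:: (Bar, 0); (Virt, 0)]
     [:: (Virt, 0); (Bar, 1)] i q n.
  by rewrite /= addn0 addn1; apply; [vm_compute | lia].
- case: ifP => // le1; case: ifP => // le _ _.
  have := @local_related 1 1 [:: (Bar, 0); (Bar, 0)] [::] i q n.
  by rewrite /= addn0; apply; [vm_compute | lia].
- case: ifP => // le1; case: ifP => // le _ _.
  have := @local_related 1 2
     [:: (Bar, 0); (Bar, 1); (Cross o, 0); (Bar, 0); (Bar, 1)]
     [:: (Virt, 0); (Cross o, 0); (Virt, 0)] i q n.
  by rewrite /= addn0 addn1; apply; [case: (o); vm_compute | lia].
Qed.

(** * The invariant of a diagram *)

Lemma strands_cat n p q : strands n (p ++ q) = obind (strands^~ q) (strands n p).
Proof.
by elim: p n => [|[g i] p IH] n //=; case: ifP.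
Qed.

Lemma twist5 u : (toF (twist u) ^+ 5 = 1)%R.
Proof. 
have : twist u = 1%num \/ twist u = 5%num \/ twist u = 9%num.
  by case: u => [|[[| |[]| |] ?] [|[[| |[]| |] ?] [|? ?]]]; auto.
by case=> [|[]] ->; apply/eqP; vm_compute.
Qed.

Definition invariant (D : diagram) : 'F_11 := (ev (slices D) [::] ^+ 5)%R.

Lemma related_invariant D D' : related D D' -> invariant D = invariant D'.
Proof.
move=> [p [u [v [q [uv eD eD']]]]]; rewrite /invariant eD eD'.
have := svalP D; have := svalP D'; rewrite /closes_up -/(slices D) -/(slices D').
(* Both diagrams close up, so the common prefix [p] ends with some number [n] of strands, on which
   the two sides of the move are compared. *)
rewrite eD eD' !(strands_cat 0 p); case e: (strands 0 p) => [n|] //=.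
move=> /eqP hv /eqP hu.
have [c c5 hc] : exists2 c, (c ^+ 5 = 1)%R & related_by c n (u ++ q) (v ++ q).
  case: uv => uv.
    by exists 1%R; [rewrite expr1n | apply: isotopy_related => //; rewrite ?hu ?hv].
  exists (toF (twist u)); first exact: twist5.
  by apply: tmove_related => //; rewrite ?hu ?hv.
by rewrite (ev_cat e hc) // exprMn c5 mul1r.
Qed.

Lemma equivalent_invariant D D' : equivalent D D' -> invariant D = invariant D'.
Proof.
by elim=> [{}D {}D' /related_invariant|{}D|{}D {}D' _ ->|{}D E F _ -> _ ->].
Qed.

Lemma ev_run w s : strands (size s) w = Some 0 -> valid (size s) s ->
  ev w s = toF (coef_sum (run w s)).
Proof.
move=> st vs; have := @ev_shift 0 w [::] [::] s [::] erefl vs.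
rewrite st => /(_ isT); rewrite /= !cats0.
have -> : shift 0 w = w by rewrite /shift -[RHS]map_id; apply: eq_map => -[].
move=> ->; rewrite toF_coef_sum /linext.
by apply: eq_bigr => x _; rewrite mulr1.
Qed.

Lemma invariant_trivial : invariant trivial_nonorientable_curve = (- 1)%R.
Proof.
rewrite /invariant ev_run //; by apply/eqP; vm_compute.
Qed.

(** * Sums over labellings of the points *)

Definition labeling : Type := point -> nat.

Definition set_label (f : labeling) (x : point) (a : nat) : labeling :=
  fun y => if y == x then a else f y.

(** Updating one running labelling, instead of summing over sequences, allows the sum to be split
    line by line and reordered along a traversal. *)
Fixpoint sum_labels (P : seq point) (f : labeling) (G : labeling -> 'F_11) :
    'F_11 :=
  if P is x :: P' then
    (\sum_(a <- labels) sum_labels P' (set_label f x a) G)%R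
  else G f.

Definition fill (f : labeling) (P : seq point) (t : seq nat) : labeling :=
  fun y => if y \in P then nth 0 t (index y P) else f y.

Lemma sum_labels_cat P Q f G :
  sum_labels (P ++ Q) f G = sum_labels P f (fun f' => sum_labels Q f' G).
Proof.
by elim: P f => [|x P IH] f //=; apply: eq_bigr => a _; rewrite IH.
Qed.

(** The factor [c] depends only on labels outside [P], so it is constant throughout the sum. *)
Lemma sum_labels_pull P f (c H : labeling -> 'F_11) :
  (forall f' : labeling, (forall y, y \notin P -> f' y = f y) -> c f' = c f) ->
  sum_labels P f (fun f' => c f' * H f')%R = (c f * sum_labels P f H)%R.
Proof.
elim: P f => [|x P IH] f //= hc; rewrite mulr_sumr; apply: eq_bigr => a _.
rewrite IH; last first.
  move=> f' hf'; rewrite !hc // => y; rewrite inE negb_or => /andP[yx yP].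
    by rewrite /set_label (negbTE yx).
  by rewrite hf' // /set_label (negbTE yx).
rewrite hc // => y; rewrite inE negb_or => /andP[yx yP].
by rewrite /set_label (negbTE yx).
Qed.

Lemma eq_sum_labels P f G G' : G =1 G' -> sum_labels P f G = sum_labels P f G'.
Proof.
by move=> e; elim: P f => [|x P IH] f //=; apply: eq_bigr => a _; rewrite IH.
Qed.

Lemma sum_all_seqsS n (F : seq nat -> 'F_11) :
  (\sum_(t <- all_seqs n.+1) F t =
   \sum_(a <- labels) \sum_(t <- all_seqs n) F (a :: t))%R.
Proof.
by rewrite all_seqsS big_allpairs_dep; apply: eq_bigr => a _.
Qed.

Lemma sum_labels_fill P f G : uniq P ->
  sum_labels P f G = (\sum_(t <- all_seqs (size P)) G (fill f P t))%R.
Proof.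
elim: P f => [|x P IH] f /=.
  by move=> _; rewrite big_seq1; congr G; apply: functional_extensionality.
move=> /andP[xP uP]; rewrite sum_all_seqsS; apply: eq_bigr => a _.
rewrite IH //; apply: eq_bigr => t _; congr G.
apply: functional_extensionality => y; rewrite /fill /set_label inE /=.
case: (eqVneq y x) => [->|yx]; first by rewrite (negbTE xP).
by [].
Qed.

Lemma set_labelC f x y a b : x != y ->
  set_label (set_label f x a) y b = set_label (set_label f y b) x a.
Proof.
move=> xy; apply: functional_extensionality => z; rewrite /set_label.
by case: (eqVneq z y) => // ->; rewrite eq_sym (negbTE xy).
Qed.

Lemma sum_labels_rem x Q f G : x \in Q -> uniq Q ->
  sum_labels Q f G = (\sum_(a <- labels) sum_labels (rem x Q) (set_label f x a) G)%R.
Proof.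
elim: Q f => [|y Q IH] f //=; rewrite inE => xyQ /andP[yQ uQ].
case: (eqVneq y x) => [->|yx] //.
have xQ : x \in Q by move: xyQ; rewrite eq_sym (negbTE yx).
transitivity (\sum_(b <- labels) \sum_(a <- labels)
   sum_labels (rem x Q) (set_label (set_label f y b) x a) G)%R.
  by apply: eq_bigr => b _; rewrite IH.
rewrite exchange_big /=; apply: eq_bigr => a _; apply: eq_bigr => b _.
by rewrite set_labelC.
Qed.

(** Independent summations commute. This permits passing from the order of the points by lines to
    their order along a traversal. *)
Lemma perm_sum_labels P Q f G : perm_eq P Q -> uniq P ->
  sum_labels P f G = sum_labels Q f G.
Proof.
elim: P Q f => [|x P IH] Q f pPQ /=; first by move: pPQ; rewrite perm_sym => /perm_nilP ->.
move=> /andP[xP uP].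
have xQ : x \in Q by rewrite -(perm_mem pPQ) mem_head.
have uQ : uniq Q by rewrite -(perm_uniq pPQ) /= xP.
rewrite (sum_labels_rem _ _ xQ uQ); apply: eq_bigr => a _; apply: IH => //.
by rewrite -(perm_cons x) (perm_trans pPQ) // perm_to_rem.
Qed.

(** * The contraction as a state sum over slices *)

Definition width (w : seq slice) (k : nat) : nat :=
  odflt 0 (strands 0 (take k w)).

Definition line (w : seq slice) (k : nat) : seq point :=
  [seq (k, p) | p <- iota 0 (width w k)].

Definition row (w : seq slice) (k : nat) (f : labeling) : seq nat :=
  [seq f x | x <- line w k].

Definition slice_at (w : seq slice) (k : nat) : slice := nth (Bar, 0) w k.

(** The matrix entry of slice [k] between the labels of the two lines bounding it. *)
Definition slice_weight (w : seq slice) (k : nat) (f : labeling) : 'F_11 :=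
  toF (coeff (act (slice_at w k) (row w k f)) (row w k.+1 f)).

Lemma width_some w k : closes_up w -> strands 0 (take k w) = Some (width w k).
Proof.
rewrite /closes_up -{1}(cat_take_drop k w) strands_cat /width.
by case: (strands 0 (take k w)).
Qed.

Lemma width0 w : width w 0 = 0. Proof. by rewrite /width take0. Qed.

Lemma width_size w : closes_up w -> width w (size w) = 0.
Proof. by rewrite /width take_size => /eqP ->. Qed.

Lemma width_slice w k : closes_up w -> k < size w ->
  (slice_at w k).2 + nbot (slice_at w k).1 <= width w k /\
  width w k.+1 =
    width w k - nbot (slice_at w k).1 + ntop (slice_at w k).1.
Proof.
move=> cw lt; have := width_some k.+1 cw.
rewrite (take_nth (Bar, 0)) // -/(slice_at w k) -cats1 strands_cat width_some //=.
by case: (slice_at w k) => g i /=; case: ifP => // le [<-].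
Qed.

Lemma points_lines w : points w = flatten [seq line w k | k <- iota 0 (size w).+1].
Proof. by []. Qed.

Lemma mem_line w k x : (x \in line w k) = (x.1 == k) && (x.2 < width w k).
Proof.
case: x => j p /=; apply/mapP/andP => [[q]|[/eqP -> lt]].
  by rewrite mem_iota /= => lt [-> ->].
by exists p; rewrite // mem_iota.
Qed.

Lemma mem_lines w K x :
  (x \in flatten [seq line w k | k <- K]) = (x.1 \in K) && (x.2 < width w x.1).
Proof.
apply/flatten_mapP/andP => [[k kK]|[kK lt]].
  by rewrite mem_line => /andP[/eqP -> lt].
by exists x.1; rewrite // mem_line eqxx.
Qed.

Lemma uniq_line w k : uniq (line w k).
Proof. by rewrite map_inj_uniq ?iota_uniq // => p q []. Qed.

Lemma uniq_lines w K : uniq K -> uniq (flatten [seq line w k | k <- K]).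
Proof.
elim: K => //= k K IH /andP[kK uK]; rewrite cat_uniq uniq_line IH // andbT /=.
apply/hasPn => x; rewrite mem_lines mem_line => /andP[xK _].
by apply: contra kK => /andP[/eqP <-].
Qed.

Lemma row_fill w k f t : size t = width w k -> row w k (fill f (line w k) t) = t.
Proof.
move=> sz; apply: (@eq_from_nth _ 0); first by rewrite !size_map size_iota.
move=> p; rewrite !size_map size_iota => lt.
rewrite (nth_map (0, 0)) ?size_map ?size_iota // /fill.
by rewrite mem_nth ?size_map ?size_iota // index_uniq ?size_map ?size_iota ?uniq_line.
Qed.

Lemma eq_row w k f f' : {in line w k, f =1 f'} -> row w k f = row w k f'.
Proof. by move=> h; apply/eq_in_map. Qed.

(** This is the expansion of a product of matrices into entries, by induction on the number [j] of
    remaining slices: each step inserts all labellings of the next line. *)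
Lemma ev_sum_labels w j k f : closes_up w -> k + j = size w ->
  valid (width w k) (row w k f) ->
  ev (drop k w) (row w k f) =
  sum_labels (flatten [seq line w k' | k' <- iota k.+1 j]) f
    (fun f' => \prod_(k <= k' < size w) slice_weight w k' f')%R.
Proof.
move=> cw; elim: j k f => [|j IH] k f ekj vk.
  by move: ekj; rewrite addn0 => ->; rewrite drop_size /= big_geq.
have lt : k < size w by lia.
have [le ew] := width_slice cw lt.
rewrite (drop_nth (Bar, 0)) // -/(slice_at w k) /=.
rewrite sum_labels_cat sum_labels_fill ?uniq_line //.
rewrite -/(linext _ (ev _)) (sum_by_value _ (uniq_all_seqs (width w k.+1))); last first.
  move=> t /mapP[x hx ->]; rewrite ew; exact: valid_act hx.
rewrite size_map size_iota big_seq [RHS]big_seq; apply: eq_bigr => t vt.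
have st : size t = width w k.+1 by move: vt; rewrite mem_all_seqs => /andP[/eqP].
set f1 := fill f _ t.
have r1 : row w k.+1 f1 = t by exact: row_fill.
have r0 : row w k f1 = row w k f.
  apply: eq_row => x; rewrite mem_line => /andP[/eqP xk _].
  by rewrite /f1 /fill mem_line xk (ltn_eqF (ltnSn k)).
rewrite (@eq_sum_labels _ _ _ (fun f' => slice_weight w k f' *
   \prod_(k.+1 <= k' < size w) slice_weight w k' f')%R); last first.
  by move=> f'; rewrite big_ltn.
(* The weight of slice [k] involves only lines [k] and [k.+1], whose labels are already fixed. *)
rewrite sum_labels_pull; last first.
  move=> f' hf'; rewrite /slice_weight.
  have e k' : k' <= k.+1 -> row w k' f' = row w k' f1.
    move=> lek'; apply: eq_row => x; rewrite mem_line => /andP[/eqP xk _].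
    by apply: hf'; rewrite mem_lines xk mem_iota; lia.
  by rewrite !e.
rewrite /slice_weight r0 r1 -IH ?r1 //; last by lia.
Qed.

Lemma ev_points w : closes_up w -> 
  ev w [::] = sum_labels (points w) (fun=> 0)
    (fun f => \prod_(0 <= k < size w) slice_weight w k f)%R.
Proof.
move=> cw; have := @ev_sum_labels w (size w) 0 (fun=> 0) cw erefl.
rewrite drop0 /row /line width0 /= => -> //.
by rewrite points_lines [iota 0 _.+1]/= map_cons [flatten _]/= sum_labels_cat /line width0.
Qed.

Definition cross_weight (o : bool) (a b c d : nat) : 'F_11 :=
  toF (coeff (outs (Cross o) [:: a; b]) [:: c; d]).

Definition crossing_factor (w : seq slice) (k : nat) (f : labeling) : 'F_11 :=
  if slice_at w k is (Cross o, i) then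
    cross_weight o (f (k, i)) (f (k, i.+1)) (f (k.+1, i)) (f (k.+1, i.+1))
  else 1%R.

Definition passes (g : gen) (m t : seq nat) : bool :=
  match g, m, t with
  | Cup, _, [:: a; b] => b == dual a
  | Cap, [:: a; b], _ => b == dual a
  | Virt, [:: a; b], [:: c; d] => (c == b) && (d == a)
  | Bar, [:: a], [:: b] => b == dual a
  | Cross _, _, _ => true
  | _, _, _ => false
  end.

(** The matrix of a slice is the matrix of its generator tensored with identities, so its entries
    are Kronecker deltas on the bystanders times an entry of the generator. *)
Lemma coeff_act g i n s t : i + nbot g <= n -> valid n s ->
  size t = n - nbot g + ntop g ->
  coeff (act (g, i) s) t =
  if (take i s == take i t) && (drop (i + nbot g) s == drop (i + ntop g) t) then
    coeff (outs g (take (nbot g) (drop i s))) (take (ntop g) (drop i t))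
  else 0%num.
Proof.
move=> le vs st.
have sz : size s = n by move: vs; rewrite /valid mem_all_seqs => /andP[/eqP].
have vm : valid (nbot g) (take (nbot g) (drop i s)).
  by apply: (@valid_take (n - i)); [lia | exact: valid_drop].
have pushed (l : comb) h : coef_sum [seq (x.1, h x) | x <- l] = coef_sum l.
  by elim: l => //= x l ->.
rewrite /coeff /act /= filter_map pushed.
set m := take (nbot g) _ in vm *; set l := outs g m.
have e x : x \in l -> (take i s ++ x.2 ++ drop (i + nbot g) s == t) =
    (take i s == take i t) && (drop (i + nbot g) s == drop (i + ntop g) t) &&
    (x.2 == take (ntop g) (drop i t)).
  move=> /(valid_outs vm); rewrite /valid mem_all_seqs => /andP[/eqP sx _].
  rewrite -{1}(cat_take_drop i t) eqseq_cat ?size_takel ?sz ?st //; try lia.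
  rewrite -{1}(cat_take_drop (ntop g) (drop i t)) drop_drop.
  rewrite eqseq_cat ?size_takel ?sx ?size_drop ?st //; try lia.
  by rewrite [ntop g + i]addnC andbCA andbC -!andbA.
have -> : [seq x <- l | preim (fun x => (x.1, take i s ++ x.2 ++ drop (i + nbot g) s))
              (fun x => x.2 == t) x] =
  [seq x <- l | (take i s == take i t) &&
     (drop (i + nbot g) s == drop (i + ntop g) t) &&
     (x.2 == take (ntop g) (drop i t))].
  by apply: eq_in_filter => x xl; exact: e.
case: andP => h; first by congr coef_sum; apply: eq_filter.
by rewrite (@eq_filter _ _ pred0) ?filter_pred0.
Qed.

Lemma dualK a : a < 8 -> dual (dual a) = a.
Proof. by do 8 (case: a => [|a] //). Qed.

Lemma dual_lt a : a < 8 -> dual a < 8.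
Proof. by do 8 (case: a => [|a] //). Qed.

Definition arcs (w : seq slice) (k : nat) (f : labeling) : Prop :=
  let: (g, i) := slice_at w k in
  [/\ forall p, p < i -> f (k.+1, p) = f (k, p),
      forall p, p < width w k - (i + nbot g) ->
        f (k.+1, i + ntop g + p) = f (k, i + nbot g + p)
    & match g with
      | Cup => f (k.+1, i.+1) = dual (f (k.+1, i))
      | Cap => f (k, i.+1) = dual (f (k, i))
      | Virt => f (k.+1, i) = f (k, i.+1) /\ f (k.+1, i.+1) = f (k, i)
      | Bar => f (k.+1, i) = dual (f (k, i))
      | Cross _ => True
      end].

Definition labeled (f : labeling) : Prop := forall x, f x < 8.

Lemma outs_weight g m t : valid (nbot g) m -> valid (ntop g) t ->
  (forall o, g <> Cross o) ->
  coeff (outs g m) t = if passes g m t then 1%num else 0%num.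
Proof.
have check g' : (if g' is Cross _ then true else
   all (fun m => all (fun t => coeff (outs g' m) t ==
     if passes g' m t then 1%num else 0%num) (all_seqs (ntop g')))
       (all_seqs (nbot g'))).
  by case: g' => [||?||]; vm_compute.
move=> vm vt ng; apply/eqP; have := check g.
by case: g vm vt ng => [||o||] vm vt ng h;
  [ | | by case: (ng o) | | ]; exact: (allP (allP h _ vm) _ vt).
Qed.

Lemma map_iota_eq (F G : nat -> nat) a b n :
  ([seq F p | p <- iota a n] == [seq G p | p <- iota b n]) =
  all (fun p => F (a + p) == G (b + p)) (iota 0 n).
Proof.
elim: n a b => //= n IH a b; rewrite eqseq_cons IH !addn0; congr (_ && _).
rewrite -[1]/(1 + 0) iotaDl all_map; apply: eq_all => p /=.
by rewrite !addSnnS.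
Qed.

Lemma valid_row w k f : labeled f -> valid (width w k) (row w k f).
Proof.
move=> hf; rewrite /valid mem_all_seqs !size_map size_iota eqxx /=.
by apply/allP => a /mapP[x _ ->].
Qed.

Lemma row_part w k f a n : a + n <= width w k ->
  take n (drop a (row w k f)) = [seq f (k, p) | p <- iota a n].
Proof.
move=> le; rewrite /row /line -map_comp -map_drop -map_take drop_iota take_iota.
by congr [seq _ | _ <- iota _ _]; lia.
Qed.

(** Away from crossings every entry is 0 or 1, so the weight is the indicator of [arcs] times the
    crossing factor. The second half starts from a nonzero weight because the crossing factor may
    itself vanish. *)
Lemma slice_weightE w k f : closes_up w -> k < size w -> labeled f ->
  (arcs w k f -> slice_weight w k f = crossing_factor w k f) /\
  (slice_weight w k f <> 0%R -> arcs w k f).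
Proof.
move=> cw lt hf; have [le ew] := width_slice cw lt.
have vs := valid_row w k hf; have vt := valid_row w k.+1 hf.
have st : size (row w k.+1 f) = width w k.+1 by rewrite !size_map size_iota.
rewrite /slice_weight /crossing_factor /arcs.
case e: (slice_at w k) le ew => [g i] /= le ew.
rewrite (coeff_act le vs) ?st //.
have -> : take i (row w k f) = [seq f (k, p) | p <- iota 0 i].
  by rewrite -[row w k f]drop0 row_part //; lia.
have -> : take i (row w k.+1 f) = [seq f (k.+1, p) | p <- iota 0 i].
  by rewrite -[row w k.+1 f]drop0 row_part //; lia.
have -> : drop (i + nbot g) (row w k f) =
    [seq f (k, p) | p <- iota (i + nbot g) (width w k - (i + nbot g))].
  rewrite -(@row_part w k f); last lia.
  by rewrite take_oversize // size_drop !size_map size_iota.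
have -> : drop (i + ntop g) (row w k.+1 f) =
    [seq f (k.+1, p) | p <- iota (i + ntop g) (width w k - (i + nbot g))].
  rewrite -(@row_part w k.+1 f); last lia.
  by rewrite take_oversize // size_drop !size_map size_iota ew; lia.
rewrite !map_iota_eq.
have vm : valid (nbot g) (take (nbot g) (drop i (row w k f))).
  by apply: (@valid_take (width w k - i)); [lia | exact: valid_drop].
have vm' : valid (ntop g) (take (ntop g) (drop i (row w k.+1 f))).
  by apply: (@valid_take (width w k.+1 - i)); [lia | exact: valid_drop].
rewrite row_part ?row_part in vm vm' *; try lia.
case: andP => [[/allP h1 /allP h2]|h]; last first.
  split=> [[a1 a2 _]|]; last by rewrite toF0.
  case: h; split; apply/allP => p; rewrite mem_iota => /andP[_ lp]; apply/eqP.
    by rewrite !add0n a1.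
  by rewrite a2.
have a1 p : p < i -> f (k.+1, p) = f (k, p).
  by move=> lp; apply/esym/eqP; have := h1 p; rewrite mem_iota !add0n; apply.
have a2 p : p < width w k - (i + nbot g) ->
    f (k.+1, i + ntop g + p) = f (k, i + nbot g + p).
  by move=> lp; apply/esym/eqP; have := h2 p; rewrite mem_iota; apply.
clear h1 h2; case: g le ew vm vm' a1 a2 {e} => [||o||] le ew vm vm' a1 a2.
- rewrite outs_weight // [passes _ _ _]/=; split=> [[_ _ ->]|]; first by rewrite eqxx.
  by case: eqP => // ->; rewrite toF0.
- rewrite outs_weight // [passes _ _ _]/=; split=> [[_ _ ->]|]; first by rewrite eqxx.
  by case: eqP => // ->; rewrite toF0.
- by split.
- rewrite outs_weight // [passes _ _ _]/=; split=> [[_ _ [-> ->]]|]; first by rewrite !eqxx.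
  by case: andP => [[/eqP -> /eqP ->]|_] //; rewrite toF0.
- rewrite outs_weight // [passes _ _ _]/=; split=> [[_ _ ->]|]; first by rewrite eqxx.
  by case: eqP => // ->; rewrite toF0.
Qed.

(** * Labellings along a traversal *)

Arguments through : simpl never.
Arguments step : simpl never.
Arguments passages : simpl never.

Definition reverse (x : state) : state := (~~ x.1, x.2).

(** Travelling up, slice [k] is entered from line [k]; travelling down, from line [k.+1]. This
    accounts for the offset [~~ x.1]. *)
Definition enters (w : seq slice) (k : nat) (x : state) : bool :=
  (x.2.1 == k + ~~ x.1) && (x.2.2 < width w x.2.1).

(* A label is read in the direction of travel, so that it does not change at
   a maximum or minimum. *)
Definition oriented (f : labeling) (x : state) : nat :=
  if x.1 then f x.2 else dual (f x.2).

Lemma slice_index_enters w k x : enters w k x -> slice_index x = k.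
Proof. by case: x => [[] [K p]] /andP[/eqP /= -> _] /=; lia. Qed.

Lemma next_slice_enters w k x : enters w k x -> next_slice w x = slice_at w k.
Proof. by rewrite /next_slice => /slice_index_enters ->. Qed.

Lemma step_enters w k up K p : enters w k (up, (K, p)) ->
  step w (up, (K, p)) =
  let: (up', p') := through (slice_at w k) up p in (up', (k + up', p')).
Proof.
move=> h; rewrite /step (next_slice_enters h) (slice_index_enters h) /=.
by case: through => [[] p'] /=; rewrite ?addn1 ?addn0.
Qed.

Lemma passages_enters w k up K p : enters w k (up, (K, p)) ->
  passages w (up, (K, p)) =
  let: (g, i) := slice_at w k in
  if involved (g, i) up p then
    match g with
    | Bar => [:: bar]
    | Cross o => [:: if ((p == i) == up) == o then Over k else Under k]
    | _ => [::]
    end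
  else [::].
Proof.
move=> h; rewrite /passages (next_slice_enters h) (slice_index_enters h).
by case: (slice_at w k).
Qed.

(** Going back through a slice retraces the same arc. At a crossing both the side and the direction
    flip, so the arc keeps its slope and hence its role as over or under strand. *)
Lemma through_reverse g i n up p up' p' :
  i + nbot g <= n -> p < (if up then n else n - nbot g + ntop g) ->
  through (g, i) up p = (up', p') ->
  [/\ p' < (if up' then n - nbot g + ntop g else n),
      through (g, i) (~~ up') p' = (~~ up, p) ,
      involved (g, i) (~~ up') p' = involved (g, i) up p
    & involved (g, i) up p -> if g is Cross _ then
        ((p' == i) == ~~ up') == ((p == i) == up) else true].
Proof.
move=> le lt; rewrite /through /involved /=.
case: ifP => [/andP[le1 lt1]|hin]; last first.
  case=> <- <-; split => //; rewrite ?negbK.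
  - by move: hin lt; case: up => /=; case: ifP; lia.
  - case: ifP => [|_]; first by move: hin lt; case: up => /=; case: ifP; lia.
    by congr (_, _); move: hin lt; case: up => /=; do ?case: ifP; lia.
  - by move: hin lt; case: up => /=; case: ifP; lia.
move: le lt lt1.
case: g => [||o||]; case: up => /= le lt lt1 [<- <-] /=;
  try (exfalso; lia); split => //; try lia.
all: try by case: (p == i); lia.
all: try by case: eqP; lia.
all: repeat match goal with |- context [?a == ?b] => case: (eqVneq a b) => ? end.
all: try by lia.
all: try by (case: ifP => ?; try (exfalso; lia)); congr (_, _); lia.
Qed.

(** A traversal visits each point in one direction only, while label conditions are imposed on
    states of both directions; this transfers information between a state and its reversal. *)
Lemma step_reverse w k x : closes_up w -> k < size w -> enters w k x ->
  [/\ enters w k (reverse (step w x)),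
      step w (reverse (step w x)) = reverse x
    & passages w (reverse (step w x)) = passages w x].
Proof.
move=> cw lt; have [le ew] := width_slice cw lt.
case: x => [up [K p]] hx; rewrite (step_enters hx) (passages_enters hx).
have /andP[/= /eqP eK ltp] := hx.
case e: (slice_at w k) le ew => [g i] /= le ew.
have ltp' : p < (if up then width w k else width w k - nbot g + ntop g).
  by rewrite -ew; move: ltp; rewrite eK; case: (up); rewrite ?addn0 ?addn1.
case et: (through (g, i) up p) => [up' p'].
have [lp' et' ei ec] := through_reverse le ltp' et.
have hx' : enters w k (~~ up', (k + up', p')).
  rewrite /enters /= negbK eqxx /=.
  by move: lp'; rewrite -ew; case: (up'); rewrite ?addn0 ?addn1.
rewrite /reverse /=; split => //.
  by rewrite (step_enters hx') e et' eK.
rewrite (passages_enters hx') e ei; case: ifP => // hin.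
by case: g ec hin {le ew e ltp' et lp' et' ei} => // o ec /ec /eqP ->.
Qed.

(** A classical passage imposes no condition: the labels before and after it are independent and
    enter through the crossing weight. *)
Definition turn (p : seq passage) (a b : nat) : Prop :=
  (p = [::] -> b = a) /\ (p = [:: bar] -> b = dual a).

Definition flow (w : seq slice) (k : nat) (f : labeling) : Prop :=
  forall x, enters w k x ->
    turn (passages w x) (oriented f x) (oriented f (step w x)).

Lemma arcs_flow w k f : closes_up w -> k < size w -> labeled f ->
  arcs w k f -> flow w k f.
Proof.
move=> cw lt hf; have [le ew] := width_slice cw lt.
rewrite /arcs => ha [up [K p]] hx; rewrite (step_enters hx) (passages_enters hx).
have /andP[/= /eqP eK ltp] := hx.
case e: (slice_at w k) le ew ha => [g i] /= le ew [a1 a2 a3].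
rewrite {}eK {hx e} in ltp *; rewrite /through /involved /oriented /=.
case: ifP => [/andP[le1 lt1]|hin].
- case: g le ew a1 a2 a3 lt1 => [||o||] /= le ew a1 a2 a3 lt1.
  + case: up ltp lt1 => /= ltp lt1; first by exfalso; lia.
    split=> // _; rewrite ?(addn0, addn1).
    case: eqP => [->|ne]; first by rewrite a3.
    have -> : p = i.+1 by lia.
    by rewrite a3 dualK.
  + case: up ltp lt1 => /= ltp lt1; last by exfalso; lia.
    split=> // _; rewrite ?(addn0, addn1).
    case: eqP => [->|ne]; first by rewrite a3 dualK.
    have -> : p = i.+1 by lia.
    by rewrite a3.
  + by split; case: eqP.
  + have [a4 a5] := a3; split=> // _; case: up ltp lt1 => /= ltp lt1.
      rewrite ?(addn0, addn1); case: eqP => [->|ne]; first by [].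
      by have -> : p = i.+1 by lia.
    rewrite ?(addn0, addn1); case: eqP => [->|ne]; first by rewrite a4.
    by have -> : p = i.+1 by [lia]; rewrite a5.
  + have ep : p = i by move: lt1; case: (up) => /=; lia.
    split=> // _; rewrite ep; case: (up); rewrite /= ?(addn0, addn1) a3 //.
    by rewrite dualK // dual_lt.
- split=> // _; case: up ltp hin => /= ltp hin; rewrite ?(addn0, addn1).
    case: ifP => lp; first by rewrite a1.
    have := a2 (p - (i + nbot g)); rewrite ?(addn0, addn1) in ltp.
    have -> : i + ntop g + (p - (i + nbot g)) = p - nbot g + ntop g by lia.
    have -> : i + nbot g + (p - (i + nbot g)) = p by lia.
    by apply; lia.
  case: ifP => lp; first by rewrite a1.
  have := a2 (p - (i + ntop g)); rewrite ?(addn0, addn1) ew in ltp.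
  have -> : i + ntop g + (p - (i + ntop g)) = p by lia.
  have -> : i + nbot g + (p - (i + ntop g)) = p - ntop g + nbot g by lia.
  by move=> -> //; lia.
Qed.

(** Each arc condition is the flow condition of one chosen state, going up from line [k], except at
    a minimum, whose strands can only be entered from above. *)
Lemma flow_arcs w k f : closes_up w -> k < size w -> labeled f ->
  flow w k f -> arcs w k f.
Proof.
move=> cw lt hf; have [le ew] := width_slice cw lt.
rewrite /flow /arcs => h.
have up p : p < width w k -> enters w k (true, (k, p)).
  by rewrite /enters /= addn0 eqxx.
have down p : p < width w k.+1 -> enters w k (false, (k.+1, p)).
  by rewrite /enters /= addn1 eqxx.
case e: (slice_at w k) le ew => [g i] /= le ew.
split.
- move=> p lp; have hx := up p ltac:(lia); have := h _ hx.
  rewrite (step_enters hx) (passages_enters hx) e /through /involved /=.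
  have -> : (i <= p < i + nbot g) = false by lia.
  by rewrite lp /turn /oriented /= ?(addn0, addn1) => -[->].
- move=> p lp; have hx := up (i + nbot g + p) ltac:(lia); have := h _ hx.
  rewrite (step_enters hx) (passages_enters hx) e /through /involved /=.
  have -> : (i <= i + nbot g + p < i + nbot g) = false by lia.
  have -> : (i + nbot g + p < i) = false by lia.
  rewrite /turn /oriented /= ?(addn0, addn1) => -[<- // _].
  by congr (f (_, _)); lia.
case: g e le ew => [||o||] //= e le ew.
- have hx := down i ltac:(lia); have := h _ hx.
  rewrite (step_enters hx) (passages_enters hx) e /through /involved /=.
  have -> : i <= i < i + 2 by lia.
  by rewrite eqxx /turn /oriented /= ?(addn0, addn1) => -[->].
- have hx := up i ltac:(lia); have := h _ hx.
  rewrite (step_enters hx) (passages_enters hx) e /through /involved /=.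
  have -> : i <= i < i + 2 by lia.
  by rewrite eqxx /turn /oriented /= ?(addn0, addn1) => -[<- // _]; rewrite dualK.
- split.
    have hx := up i.+1 ltac:(lia); have := h _ hx.
    rewrite (step_enters hx) (passages_enters hx) e /through /involved /=.
    have -> : i <= i.+1 < i + 2 by lia.
    have -> : (i.+1 == i) = false by lia.
    by rewrite /turn /oriented /= ?(addn0, addn1) => -[->].
  have hx := up i ltac:(lia); have := h _ hx.
  rewrite (step_enters hx) (passages_enters hx) e /through /involved /=.
  have -> : i <= i < i + 2 by lia.
  by rewrite eqxx /turn /oriented /= ?(addn0, addn1) => -[->].
- have hx := up i ltac:(lia); have := h _ hx.
  rewrite (step_enters hx) (passages_enters hx) e /through /involved /=.
  have -> : i <= i < i + 1 by lia.
  by rewrite /turn /oriented /= ?(addn0, addn1) => -[_ ->].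
Qed.

(** * Positions along a traversal *)

Definition state_at (s : seq state) (j : nat) : state := nth (true, (0, 0)) s j.

Definition places (s : seq state) : seq point := [seq x.2 | x <- s].

Definition cyclic_succ (s : seq state) (j : nat) : nat := j.+1 %% size s.

Lemma traversal_step w s j : traversal w s -> j < size s ->
  step w (state_at s j) = state_at s (cyclic_succ s j).
Proof.
case: s => // x s /andP[/= /(pathP (true, (0, 0))) h _] lt.
have := h j; rewrite size_rcons => /(_ lt) /eqP.
rewrite -rcons_cons nth_rcons lt => ->; rewrite nth_rcons /cyclic_succ /state_at /=.
case: ltngtP => [lj|lj|->]; last by rewrite modnn.
  by rewrite modn_small.
by move: lt; rewrite ltnS leqNgt lj.
Qed.

Lemma traversal_uniq w s : traversal w s -> uniq (places s).
Proof. by case/andP=> _ /perm_uniq ->; rewrite points_lines uniq_lines ?iota_uniq. Qed.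

Lemma traversal_mem w s x : traversal w s ->
  (x \in places s) = (x.1 <= size w) && (x.2 < width w x.1).
Proof.
case/andP=> _ /perm_mem ->; rewrite points_lines mem_lines mem_iota.
by rewrite add0n ltnS.
Qed.

Lemma state_at_place w s j : traversal w s -> j < size s ->
  (state_at s j).2 \in places s.
Proof. by move=> _ lt; apply: map_f; apply: mem_nth. Qed.

Lemma index_place w s j : traversal w s -> j < size s ->
  index (state_at s j).2 (places s) = j.
Proof.
move=> hs lt; rewrite -[(state_at s j).2](nth_map _ (0, 0) snd) //.
by rewrite index_uniq ?size_map // (traversal_uniq hs).
Qed.

Lemma cyclic_succ_lt s j : j < size s -> cyclic_succ s j < size s.
Proof. by move=> lt; rewrite ltn_mod; lia. Qed.

Lemma cyclic_succ_onto s j : j < size s ->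
  exists2 i, i < size s & cyclic_succ s i = j.
Proof.
case: j => [|j] lt; last by exists j; [lia | rewrite /cyclic_succ modn_small].
exists (size s).-1; first lia.
by rewrite /cyclic_succ prednK // modnn.
Qed.

Lemma state_at_enters w s j : closes_up w -> traversal w s -> j < size s ->
  slice_index (state_at s j) < size w /\
  enters w (slice_index (state_at s j)) (state_at s j).
Proof.
move=> cw hs lt; have := state_at_place hs lt; rewrite (traversal_mem _ hs).
case: (state_at s j) => [[] [k p]] /= /andP[le lp]; rewrite /enters /= lp andbT.
  have ne : k <> size w by move=> e; move: lp; rewrite e width_size.
  by split; lia.
have ne : k <> 0 by move=> e; move: lp; rewrite e width0.
by split; lia.
Qed.

(* In the second case the traversal runs through the arc of [x] backwards. *)
Lemma enters_traversed w s k x : closes_up w -> traversal w s -> k < size w ->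
  enters w k x -> exists2 j, j < size s &
    x = state_at s j \/
    x = reverse (state_at s (cyclic_succ s j)) /\
    [/\ enters w k (state_at s j), step w x = reverse (state_at s j)
      & passages w x = passages w (state_at s j)].
Proof.
move=> cw hs lt hx.
have xP : x.2 \in places s.
  rewrite (traversal_mem _ hs); case/andP: hx => /eqP e ->.
  by rewrite e andbT; case: (x.1) => /=; lia.
have [y ys ex] := mapP xP.
have lj : index y s < size s by rewrite index_mem.
have ey : state_at s (index y s) = y by rewrite /state_at nth_index.
case: (eqVneq x.1 y.1) => hd.
  exists (index y s) => //; left; rewrite ey.
  by case: x y hd ex {hx xP ys lj ey} => [a b] [c d] /= -> ->.
have exy : x = reverse y.
  by case: x y hd ex {hx xP ys lj ey} => [[] b] [[] d] //= _ ->.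
(* Here [x] reverses the traversal state [y], so it runs backwards through the slice that led to
   [y], which is the one entered by the predecessor of [y]. *)
have [i li ei] := cyclic_succ_onto lj.
exists i => //; right; have es := traversal_step hs li; rewrite ei ey in es *.
have [lk hi] := state_at_enters cw hs li.
have [h1 h2 h3] := step_reverse cw lk hi.
rewrite es -exy in h1 h2 h3.
have ek : slice_index (state_at s i) = k.
  by rewrite -(slice_index_enters h1) (slice_index_enters hx).
by rewrite ek in hi *.
Qed.

Definition orient_seq (s : seq state) (u : seq nat) : seq nat :=
  [seq if x.1.1 then x.2 else dual x.2 | x <- zip s u].

Definition labeling_of (s : seq state) (u : seq nat) : labeling :=
  fill (fun=> 0) (places s) (orient_seq s u).

(** [dual] permutes the labels, so the summation may be reindexed at every state travelling
    downwards. *)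
Lemma sum_orient s (F : seq nat -> 'F_11) :
  (\sum_(t <- all_seqs (size s)) F t =
   \sum_(u <- all_seqs (size s)) F (orient_seq s u))%R.
Proof.
elim: s F => [|x s IH] F; first by rewrite !big_seq1.
rewrite /= !sum_all_seqsS.
have pd : perm_eq labels [seq dual a | a <- labels] by [].
case ex : x.1; last rewrite (perm_big _ pd) big_map /=.
  by apply: eq_bigr => a _; rewrite IH; apply: eq_bigr => u _; rewrite /orient_seq /= ex.
by apply: eq_bigr => a _; rewrite IH; apply: eq_bigr => u _; rewrite /orient_seq /= ex.
Qed.

Lemma oriented_labeling w s u j : traversal w s -> u \in all_seqs (size s) ->
  j < size s -> oriented (labeling_of s u) (state_at s j) = nth 0 u j.
Proof.
move=> hs; rewrite mem_all_seqs => /andP[/eqP su /allP au] lt.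
rewrite /oriented /labeling_of /fill (state_at_place hs lt) (index_place hs lt).
rewrite /orient_seq (nth_map ((true, (0, 0)), 0)) ?size_zip ?su ?minnn // nth_zip //=.
rewrite -/(state_at s j); case: (state_at s j).1 => //.
by rewrite dualK // au // mem_nth // su.
Qed.

Lemma labeled_labeling_of s u : u \in all_seqs (size s) -> labeled (labeling_of s u).
Proof.
rewrite mem_all_seqs => /andP[/eqP su /allP au] x.
rewrite /labeling_of /fill; case: ifP => // xP.
have lt : index x (places s) < size s by rewrite -(size_map snd) index_mem.
rewrite /orient_seq (nth_map ((true, (0, 0)), 0)) ?size_zip ?su ?minnn // nth_zip //=.
have h : nth 0 u (index x (places s)) < 8 by apply: au; rewrite mem_nth ?su.
by case: ifP => // _; exact: dual_lt.
Qed.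

Definition turnb (p : seq passage) (a b : nat) : bool :=
  match p with
  | [::] => b == a
  | [:: None] => b == dual a
  | _ => true
  end.

Lemma turnP p a b : reflect (turn p a b) (turnb p a b).
Proof.
case: p => [|[c|] [|y p]] /=; try by constructor; split.
  by apply: (iffP eqP) => [->|[h _]]; [split | exact: h].
by apply: (iffP eqP) => [->|[_ h]]; [split | exact: h].
Qed.

Definition consistent (w : seq slice) (s : seq state) (u : seq nat) : bool :=
  all (fun j => turnb (passages w (state_at s j)) (nth 0 u j)
                      (nth 0 u (cyclic_succ s j))) (iota 0 (size s)).

Lemma consistentP w s u : closes_up w -> traversal w s ->
  u \in all_seqs (size s) ->
  reflect (forall k, k < size w -> flow w k (labeling_of s u)) (consistent w s u).
Proof.
move=> cw hs hu; have hl := labeled_labeling_of hu.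
have lab j := @oriented_labeling w s u j hs hu.
apply: (iffP allP) => [h k lk x hx|h j].
  have [j lj] := enters_traversed cw hs lk hx.
  have hj : turn (passages w (state_at s j)) (nth 0 u j) (nth 0 u (cyclic_succ s j)).
    by apply/turnP/h; rewrite mem_iota.
  have lj' := cyclic_succ_lt lj.
  case=> [->|[ex [hi es ep]]].
    by rewrite (traversal_step hs lj) !lab.
  rewrite ep es ex.
  have orev y : oriented (labeling_of s u) (reverse y) =
      dual (oriented (labeling_of s u) y).
    rewrite /oriented /=; case: y.1 => //=; by rewrite dualK.
  (* For an arc run backwards, the condition is the forward one with both labels dualised and
     exchanged; it follows since [dual] is an involution. *)
  rewrite !orev !lab //; case: hj => h0 h1; split=> [/h0 ->|/h1 ->] //.
  rewrite dualK //; apply: dual_lt; rewrite -(lab _ lj) /oriented.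
  by case: ifP => _; [exact: hl | apply: dual_lt; exact: hl].
rewrite mem_iota => /= lj; apply/turnP.
have [lk hx] := state_at_enters cw hs lj.
by have := h _ lk _ hx; rewrite (traversal_step hs lj) !lab // cyclic_succ_lt.
Qed.

Lemma ev_traversal w s : closes_up w -> traversal w s ->
  ev w [::] = (\sum_(u <- all_seqs (size s) | consistent w s u)
    \prod_(0 <= k < size w) crossing_factor w k (labeling_of s u))%R.
Proof.
move=> cw hs; rewrite ev_points //.
have [_ ps] := andP hs.
rewrite -(perm_sum_labels _ _ ps) ?(traversal_uniq hs) //.
rewrite sum_labels_fill ?(traversal_uniq hs) // size_map sum_orient.
rewrite big_mkcond [RHS]big_mkcond big_seq [RHS]big_seq.
apply: eq_bigr => u hu; rewrite -/(labeling_of s u) /=.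
have hl := labeled_labeling_of hu.
case: (consistentP cw hs hu) => [h|h].
  rewrite !big_nat; apply: eq_bigr => k /andP[_ lk].
  have [h1 _] := slice_weightE cw lk hl.
  by apply: h1; apply: flow_arcs => //; exact: h.
(* If the product of slice weights is nonzero, then so is every factor, and all arc conditions hold;
   inconsistent labellings therefore contribute 0. *)
apply/eqP; apply: contra_notT h => ne k lk.
have [_ h2] := slice_weightE cw lk hl.
apply: arcs_flow => //; apply: h2 => e; move/negP: ne; apply; apply/eqP.
by rewrite (bigD1_seq k) ?mem_index_iota ?iota_uniq //= e mul0r.
Qed.

(** * From points of the traversal to arcs of the code *)

Definition code_before (w : seq slice) (s : seq state) (j : nat) : nat :=
  size (code w (take j s)).

Lemma passages_cases w x :
  passages w x = [::] \/ exists a, passages w x = [:: a].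
Proof.
case: x => up [K p]; rewrite /passages; case: (next_slice _ _) => g i.
case: ifP => _; last by left.
by case: g => [||o||]; [left | left | right; eexists | left | right; eexists].
Qed.

Lemma code_cat w s t : code w (s ++ t) = code w s ++ code w t.
Proof. by rewrite /code map_cat flatten_cat. Qed.

Lemma code_takeS w s j : j < size s ->
  code w (take j.+1 s) = code w (take j s) ++ passages w (state_at s j).
Proof.
move=> lt; rewrite (take_nth (true, (0, 0))) // -cats1 code_cat.
by rewrite /code /= cats0.
Qed.

Lemma code_beforeS w s j : j < size s ->
  code_before w s j.+1 = code_before w s j + size (passages w (state_at s j)).
Proof. by move=> lt; rewrite /code_before code_takeS // size_cat. Qed.

Lemma code_before_mono w s i j : i <= j -> code_before w s i <= code_before w s j.
Proof.
move=> le; rewrite /code_before -[take j s](cat_take_drop i) code_cat size_cat.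
by rewrite take_takel // leq_addr.
Qed.

Lemma code_before0 w s : code_before w s 0 = 0.
Proof. by rewrite /code_before take0. Qed.

Lemma code_before_size w s : code_before w s (size s) = size (code w s).
Proof. by rewrite /code_before take_size. Qed.

Lemma nth_code_before w s j a : j < size s -> passages w (state_at s j) = [:: a] ->
  code_before w s j < size (code w s) /\ nth bar (code w s) (code_before w s j) = a.
Proof.
move=> lt e; split.
  rewrite -code_before_size; have := @code_before_mono w s j.+1 _ lt.
  by rewrite code_beforeS // e addn1.
rewrite -{1}(cat_take_drop j.+1 s) code_cat code_takeS // e -catA nth_cat.
by rewrite ltnn subnn.
Qed.

Lemma code_before_event w s e : e < size (code w s) ->
  exists2 j, j < size s & code_before w s j = e /\
    passages w (state_at s j) = [:: nth bar (code w s) e].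
Proof.
move=> lt; suff [j lj [ej [a pa]]] : exists2 j, j < size s &
    code_before w s j = e /\ exists a, passages w (state_at s j) = [:: a].
  exists j => //; split=> //; have [_ e'] := nth_code_before lj pa.
  by rewrite pa -ej e'.
have h n : n <= size s -> e < code_before w s n -> exists2 j, j < n &
    code_before w s j = e /\ exists a, passages w (state_at s j) = [:: a].
  elim: n => [|n IH] ln; first by rewrite code_before0.
  rewrite code_beforeS //; case: (ltnP e (code_before w s n)) => [le _|le].
    by have [j lj hj] := IH (ltnW ln) le; exists j => //; exact: ltnW.
  case: (passages_cases w (state_at s n)) => [->|[a pa]]; first by rewrite /=; lia.
  by rewrite pa /= => le'; exists n => //; split; [lia | exists a].
by have [j lj hj] := h (size s) (leqnn _) ltac:(by rewrite code_before_size); exists j.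
Qed.

Lemma event_inj w s i j a b : i < size s -> j < size s ->
  passages w (state_at s i) = [:: a] -> passages w (state_at s j) = [:: b] ->
  code_before w s i = code_before w s j -> i = j.
Proof.
move=> li lj pa pb e; case: (ltngtP i j) => // lt.
  by have := @code_before_mono w s i.+1 j lt; rewrite code_beforeS // pa /=; lia.
by have := @code_before_mono w s j.+1 i lt; rewrite code_beforeS // pb /=; lia.
Qed.

(* [l] labels the arcs between consecutive passages, arc [e] ending at passage
   number [e]; the arc after the last passage is arc 0 again. *)
Definition expand (w : seq slice) (s : seq state) (l : seq nat) : seq nat :=
  mkseq (fun j => nth 0 l (code_before w s j %% size (code w s))) (size s).

Definition bars_turn (c : seq passage) (l : seq nat) : bool :=
  all (fun e => (nth bar c e == bar) ==>
                (nth 0 l (e.+1 %% size c) == dual (nth 0 l e))) (iota 0 (size c)).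

(** All states on arc [e] have [code_before] equal to [e]; the second condition selects the last of
    them, where passage [e] takes place. *)
Definition event (w : seq slice) (s : seq state) (e : nat) : nat :=
  find (fun j => (code_before w s j == e) && (passages w (state_at s j) != [::]))
       (iota 0 (size s)).

Lemma eventP w s e : e < size (code w s) ->
  [/\ event w s e < size s, code_before w s (event w s e) = e
    & passages w (state_at s (event w s e)) = [:: nth bar (code w s) e]].
Proof.
move=> /code_before_event[j lj [ej pj]].
set P := fun j => (code_before w s j == e) && (passages w (state_at s j) != [::]).
have hP : has P (iota 0 (size s)).
  by apply/hasP; exists j; rewrite ?mem_iota // /P ej eqxx pj.
have lt : event w s e < size s by move: hP; rewrite has_find size_iota.
have /andP[/eqP h1 h2] := nth_find 0 hP.
rewrite nth_iota // add0n in h1 h2.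
have -> : event w s e = j; last by [].
have [h|[a pa]] := passages_cases w (state_at s (event w s e)).
  by rewrite h in h2.
by apply: (event_inj lt lj pa pj); rewrite h1.
Qed.

Lemma code_before_cyclic w s j : j < size s -> 0 < size (code w s) ->
  code_before w s (cyclic_succ s j) %% size (code w s) =
  code_before w s j.+1 %% size (code w s).
Proof.
move=> lj c0; rewrite /cyclic_succ.
case: (ltngtP j.+1 (size s)) => [lt|lt|->].
  by rewrite [j.+1 %% _]modn_small.
  by exfalso; lia.
by rewrite modnn code_before0 code_before_size modnn mod0n.
Qed.

Lemma nth_expand w s l j : j < size s ->
  nth 0 (expand w s l) j = nth 0 l (code_before w s j %% size (code w s)).
Proof. by move=> lj; rewrite nth_mkseq. Qed.

Lemma expand_consistent w s l : 0 < size (code w s) ->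
  bars_turn (code w s) l -> consistent w s (expand w s l).
Proof.
move=> c0 /allP hb; apply/allP => j; rewrite mem_iota => /= lj; apply/turnP.
rewrite !nth_expand ?cyclic_succ_lt // code_before_cyclic // code_beforeS //.
split=> h; first by rewrite h addn0.
have [lt e] := nth_code_before lj h.
rewrite h addn1 [code_before w s j %% _]modn_small //.
have := hb (code_before w s j); rewrite mem_iota /= => /(_ lt).
by rewrite e eqxx => /eqP.
Qed.

(** Labels are constant between passages, so each state carries the label of the state ending its
    arc. *)
Lemma consistent_expand w s u : 0 < size (code w s) -> size u = size s ->
  consistent w s u ->
  let l := mkseq (fun e => nth 0 u (event w s e)) (size (code w s)) in
  u = expand w s l /\ bars_turn (code w s) l.
Proof.
move=> c0 su /allP hu l.
have turnE j : j < size s ->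
    turn (passages w (state_at s j)) (nth 0 u j) (nth 0 u (cyclic_succ s j)).
  by move=> lj; apply/turnP/hu; rewrite mem_iota.
have at_event j a : j < size s -> passages w (state_at s j) = [:: a] ->
    nth 0 u j = nth 0 l (code_before w s j %% size (code w s)).
  move=> lj pj; have [lt e] := nth_code_before lj pj.
  rewrite modn_small // nth_mkseq //; have [le ee pe] := eventP lt.
  by congr nth; apply: (event_inj lj le pj pe).
(* Induction on the distance [d] to some later passage. *)
have before d j : j + d < size s ->
    (exists a, passages w (state_at s (j + d)) = [:: a]) ->
    nth 0 u j = nth 0 l (code_before w s j %% size (code w s)).
  elim: d j => [|d IH] j lj [a pa].
    by rewrite addn0 in lj pa; exact: at_event pa.
  have lj' : j < size s by lia.
  case: (passages_cases w (state_at s j)) => [pj|[b pj]]; last exact: at_event pj.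
  have [h _] := turnE _ lj'; rewrite -(h pj) /cyclic_succ modn_small; last lia.
  rewrite IH; [|lia|by exists a; rewrite addSnnS].
  by rewrite code_beforeS // pj addn0.
have at0 : nth 0 u 0 = nth 0 l 0.
  have [le ee pe] := eventP c0.
  rewrite (@before (event w s 0) 0) //; last by eexists; exact: pe.
  by rewrite code_before0 mod0n.
(* States beyond the last passage are reached by induction on the distance to the end; there the
   traversal wraps around to state 0, on arc 0. *)
have all_j d j : j + d = size s -> j < size s ->
    nth 0 u j = nth 0 l (code_before w s j %% size (code w s)).
  elim: d j => [|d IH] j ej lj; first lia.
  case: (passages_cases w (state_at s j)) => [pj|[b pj]]; last exact: at_event pj.
  have [h _] := turnE _ lj; rewrite -(h pj).
  have -> : code_before w s j = code_before w s j.+1.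
    by rewrite code_beforeS // pj addn0.
  rewrite /cyclic_succ; case: (ltngtP j.+1 (size s)) => [lt|lt|e].
  - by rewrite [j.+1 %% _]modn_small // IH // addSnnS.
  - lia.
  - by rewrite e modnn at0 code_before_size modnn.
have eu : u = expand w s l.
  apply: (@eq_from_nth _ 0); first by rewrite size_mkseq.
  by move=> j; rewrite su => lj; rewrite nth_expand // (all_j (size s - j)) //; lia.
split=> //; apply/allP => e; rewrite mem_iota => /= le; apply/implyP => /eqP eb.
have [lj ej pj] := eventP le.
have [_ h] := turnE _ lj; rewrite eb in pj; move: (h pj).
rewrite eu !nth_expand ?cyclic_succ_lt // code_before_cyclic // code_beforeS //.
by rewrite pj ej addn1 [e %% _]modn_small // => ->.
Qed.

Lemma expand_valid w s l : 0 < size (code w s) -> l \in all_seqs (size (code w s)) ->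
  expand w s l \in all_seqs (size s).
Proof.
move=> c0; rewrite !mem_all_seqs size_mkseq eqxx => /andP[/eqP sl /allP al] /=.
apply/allP => a /mapP[j _ ->]; apply: al; apply: mem_nth.
by rewrite sl ltn_mod.
Qed.

(** [expand] is a bijection from arc labellings respecting the bars to consistent labellings of the
    states; its inverse reads the label at each event. *)
Lemma ev_code w s : closes_up w -> traversal w s -> 0 < size (code w s) ->
  ev w [::] = (\sum_(l <- all_seqs (size (code w s)) | bars_turn (code w s) l)
    \prod_(0 <= k < size w) crossing_factor w k (labeling_of s (expand w s l)))%R.
Proof.
move=> cw hs c0; rewrite (ev_traversal cw hs).
set C := size (code w s) in c0 *.
have p : perm_eq [seq u <- all_seqs (size s) | consistent w s u]
   [seq expand w s l | l <- [seq l <- all_seqs C | bars_turn (code w s) l]].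
  apply: uniq_perm; first by rewrite filter_uniq ?uniq_all_seqs.
    rewrite map_inj_in_uniq ?filter_uniq ?uniq_all_seqs // => l l'.
    rewrite !mem_filter !mem_all_seqs => /andP[_ /andP[/eqP sl _]].
    move=> /andP[_ /andP[/eqP sl' _]] e.
    apply: (@eq_from_nth _ 0); first by rewrite sl'.
    rewrite sl => i li; have [le ee _] := eventP li.
    have := congr1 (fun v => nth 0 v (event w s i)) e.
    by rewrite !nth_expand // ee modn_small.
  move=> u; rewrite mem_filter; apply/andP/mapP => [[cu hu]|[l]].
    have su : size u = size s by move: hu; rewrite mem_all_seqs => /andP[/eqP].
    have [eu hb] := consistent_expand c0 su cu.
    eexists; last exact: eu.
    rewrite mem_filter hb mem_all_seqs size_mkseq eqxx /=.
    apply/allP => a /mapP[e]; rewrite mem_iota => /= le ->.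
    have [le' _ _] := eventP le.
    by move: hu; rewrite mem_all_seqs => /andP[_ /allP]; apply; rewrite mem_nth // su.
  rewrite mem_filter => /andP[hb hl] ->.
  by split; [exact: expand_consistent | exact: expand_valid].
by rewrite -big_filter (perm_big _ p) big_map big_filter.
Qed.

(** * The weights of the crossings *)

Definition cross_coeff (o : bool) (a b c d : nat) : N :=
  coeff (outs (Cross o) [:: a; b]) [:: c; d].

(** The crossing drawn with both strands pointing up: for a positive one the over strand starts at
    bottom left, for a negative one at bottom right. *)
Definition strand_coeff (sg : bool) (oi oo ui uo : nat) : N :=
  if sg then cross_coeff true oi ui uo oo else cross_coeff false ui oi oo uo.

Definition directed (up : bool) (a b : nat) : nat * nat :=
  if up then (a, b) else (dual b, dual a).

(* The weight of a crossing depends only on its sign and on the labels read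
   along its two strands, whose directions are [uy] and [uz]. *)
Definition cross_strands (o uy uz : bool) (a b c d : nat) : N :=
  let: (oi, oo) := if o then directed uy a d else directed uy b c in
  let: (ui, uo) := if o then directed uz b c else directed uz a d in
  strand_coeff (o == (uy == uz)) oi oo ui uo.

Lemma cross_strands_checked :
  all (fun o => all (fun uy => all (fun uz =>
    all (fun a => all (fun b => all (fun c => all (fun d =>
      cross_coeff o a b c d == cross_strands o uy uz a b c d)
    labels) labels) labels) labels)
  [:: false; true]) [:: false; true]) [:: false; true].
Proof. by vm_compute. Qed.

Lemma cross_strandsE o uy uz a b c d : a < 8 -> b < 8 -> c < 8 -> d < 8 ->
  cross_coeff o a b c d = cross_strands o uy uz a b c d.
Proof.
have mb x : x \in [:: false; true] by case: x.
have ml x : x < 8 -> x \in labels by rewrite mem_iota.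
move=> ha hb hc hd; apply/eqP.
have h := allP (allP (allP cross_strands_checked o (mb o)) uy (mb uy)) uz (mb uz).
exact: (allP (allP (allP (allP h _ (ml _ ha)) _ (ml _ hb)) _ (ml _ hc)) _ (ml _ hd)).
Qed.

Lemma passage_slice w k x b c : enters w k x -> passages w x = [:: Some (b, c)] ->
  exists o i, [/\ slice_at w k = (Cross o, i), c = k, i <= x.2.2 < i + 2
    & ((x.2.2 == i) == x.1) = (b == o)].
Proof.
case: x => [up [K p]] hx; rewrite (passages_enters hx).
case: (slice_at w k) => g i; case: ifP => // hin.
case: g hin => // o; rewrite /involved /= => hin h; exists o, i.
have hp : i <= p < i + 2 by move: hin; rewrite /nentry /=; case: (up).
move: h; case: ((p == i) == up) => /=; case: (o) => /= -[<- <-].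
all: by split.
Qed.

Lemma state_determined w k x y b c : enters w k x -> enters w k y -> x.1 = y.1 ->
  passages w x = [:: Some (b, c)] -> passages w y = [:: Some (b, c)] -> x = y.
Proof.
move=> hx hy e px py.
have [o [i [es _ hp ep]]] := passage_slice hx px.
have [o' [i' [es' _ hp' ep']]] := passage_slice hy py.
move: es'; rewrite es => -[eo ei]; subst o' i'.
have e2 : (x.2.2 == i) = (y.2.2 == i).
  by move: ep; rewrite -ep' e; case: (_ == i); case: (_ == i); case: (y.1).
case: x y e hx hy hp hp' e2 {px py ep ep'} => [up [K p]] [up' [K' p']] /= <-.
rewrite /enters /= => /andP[/eqP -> _] /andP[/eqP -> _] hp hp' e2.
by congr (_, (_, _)); move: e2; case: eqP; case: eqP; lia.
Qed.

(** Two visits in the same direction are the same state. Visits in opposite directions would make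
    the traversal turn back on the arc just travelled, but a crossing preserves the vertical
    direction. *)
Lemma passage_unique w s i j b c : closes_up w -> traversal w s ->
  i < size s -> j < size s ->
  passages w (state_at s i) = [:: Some (b, c)] ->
  passages w (state_at s j) = [:: Some (b, c)] -> i = j.
Proof.
move=> cw hs li lj pi pj.
have [lk hi] := state_at_enters cw hs li.
have [_ hj] := state_at_enters cw hs lj.
have [oi [ii [si ei _ _]]] := passage_slice hi pi.
have [oj [ij [sj ej _ _]]] := passage_slice hj pj.
rewrite -ei in lk hi si; rewrite -ej in hj sj.
have same i' : i' < size s -> (state_at s i').2 = (state_at s j).2 -> i' = j.
  by move=> li' e; rewrite -(index_place hs li') e (index_place hs lj).
case: (eqVneq (state_at s i).1 (state_at s j).1) => e.
  by apply: same => //; rewrite (state_determined hi hj e pi pj).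
have [h1 _ h3] := step_reverse cw lk hi.
have ed : (step w (state_at s i)).1 = (state_at s i).1.
  case: (state_at s i) hi => [up [K p]] hi; rewrite (step_enters hi) si.
  by rewrite /through; case: ifP.
have er : reverse (step w (state_at s i)) = state_at s j.
  apply: (state_determined h1 hj _ _ pj); last by rewrite h3.
  by rewrite /= ed; move: e; case: (_.1); case: (_.1).
rewrite (traversal_step hs li) in er ed.
have e2 : cyclic_succ s i = j.
  by apply: same; [exact: cyclic_succ_lt | rewrite -er].
by exfalso; move: e; rewrite -e2 ed eqxx.
Qed.

Lemma crossing_factor_strands w k f x y sg : closes_up w -> k < size w -> labeled f ->
  enters w k x -> enters w k y ->
  passages w x = [:: Over k] -> passages w y = [:: Under k] ->
  Num.sg ((direction w x).1 * (direction w y).2 -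
          (direction w x).2 * (direction w y).1)%R = (if sg then 1 else -1)%R ->
  crossing_factor w k f =
  toF (strand_coeff sg (oriented f x) (oriented f (step w x))
                       (oriented f y) (oriented f (step w y))).
Proof.
move=> cw lk hf hx hy px py.
have [o [i [es _ hp ep]]] := passage_slice hx px.
have [o' [i' [es' _ hp' ep']]] := passage_slice hy py.
move: es'; rewrite es => -[eo ei]; subst o' i'.
rewrite /crossing_factor es /cross_weight -/(cross_coeff _ _ _ _ _).
case: x hx hp ep {px} => [ux [Kx p]] hx /= hp ep.
case: y hy hp' ep' {py} => [uy [Ky q]] hy /= hq eq.
rewrite (step_enters hx) (step_enters hy) es /direction.
rewrite (next_slice_enters hx) (next_slice_enters hy) es /=.
have /andP[/= /eqP -> _] := hx; have /andP[/= /eqP -> _] := hy.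
rewrite /through /involved /nentry /=.
have -> : (i <= p < i + (if ux then 2 else 2)) by case: (ux).
have -> : (i <= q < i + (if uy then 2 else 2)) by case: (uy).
rewrite (@cross_strandsE o ux uy) //.
have [P|P] : p = i \/ p = i.+1 by lia.
all: have [Q|Q] : q = i \/ q = i.+1 by lia.
all: subst p q; rewrite ?eqxx ?(gtn_eqF (ltnSn i)) in ep eq *.
all: move: ep eq; case: ux {hx}; case: uy {hy}; case: o {es} => //= _ _.
all: rewrite /oriented /= ?addn0 ?addn1.
all: by case: sg.
Qed.

(** * Crossing weights read off the code *)

Definition event_state (w : seq slice) (s : seq state) (e : nat) : state :=
  state_at s (event w s e).

Lemma event_stateP w s e : closes_up w -> traversal w s -> e < size (code w s) ->
  [/\ slice_index (event_state w s e) < size w,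
      enters w (slice_index (event_state w s e)) (event_state w s e)
    & passages w (event_state w s e) = [:: nth bar (code w s) e]].
Proof.
move=> cw hs le; have [lj _ pj] := eventP le.
by have [lk hx] := state_at_enters cw hs lj.
Qed.

Lemma event_labels w s l e : closes_up w -> traversal w s ->
  l \in all_seqs (size (code w s)) -> e < size (code w s) ->
  let f := labeling_of s (expand w s l) in
  oriented f (event_state w s e) = nth 0 l e /\
  oriented f (step w (event_state w s e)) = nth 0 l (e.+1 %% size (code w s)).
Proof.
move=> cw hs hl le f; have [lj ej pj] := eventP le.
have c0 : 0 < size (code w s) by lia.
have hu := expand_valid c0 hl.
rewrite /event_state (traversal_step hs lj) /f.
rewrite !(oriented_labeling hs hu) ?cyclic_succ_lt // !nth_expand ?cyclic_succ_lt //.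
by rewrite code_before_cyclic // code_beforeS // pj ej addn1 [e %% _]modn_small.
Qed.

Lemma event_slice w s e b c : closes_up w -> traversal w s -> e < size (code w s) ->
  nth bar (code w s) e = Some (b, c) ->
  [/\ c < size w, enters w c (event_state w s e)
    & passages w (event_state w s e) = [:: Some (b, c)]].
Proof.
move=> cw hs le en; have [lk hx px] := event_stateP cw hs le.
rewrite en in px; have [o [i [_ ec _ _]]] := passage_slice hx px.
by rewrite -ec in lk hx.
Qed.

Lemma code_uniq w s e e' b c : closes_up w -> traversal w s ->
  e < size (code w s) -> e' < size (code w s) ->
  nth bar (code w s) e = Some (b, c) -> nth bar (code w s) e' = Some (b, c) ->
  e = e'.
Proof.
move=> cw hs le le' en en'.
have [lj ej pj] := eventP le; have [lj' ej' pj'] := eventP le'.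
rewrite en in pj; rewrite en' in pj'.
by rewrite -ej -ej' (passage_unique cw hs lj lj' pj pj').
Qed.

Lemma direction_at_event w s e b c : closes_up w -> traversal w s ->
  e < size (code w s) -> nth bar (code w s) e = Some (b, c) ->
  direction_at w s (Some (b, c)) = direction w (event_state w s e).
Proof.
move=> cw hs le en; have [lj ej pj] := eventP le; rewrite en in pj.
rewrite /direction_at.
have xs : event_state w s e \in [seq x <- s | Some (b, c) \in passages w x].
  by rewrite mem_filter /event_state pj mem_head mem_nth.
case ef : [seq x <- s | _] xs => [|y t] // _ /=.
have : y \in [seq x <- s | Some (b, c) \in passages w x] by rewrite ef mem_head.
rewrite mem_filter => /andP[hp /(nthP (true, (0, 0)))[j lj' ey]].
rewrite -ey -/(state_at s j) in hp *.
congr direction; rewrite /event_state; congr (state_at s _).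
apply: (passage_unique cw hs lj' lj _ pj).
case: (passages_cases w (state_at s j)) hp => [->|[a ->]] //.
by rewrite inE => /eqP <-.
Qed.

Lemma event_crossing_factor w s l c eo eu (sg : bool) :
  closes_up w -> traversal w s -> l \in all_seqs (size (code w s)) ->
  eo < size (code w s) -> eu < size (code w s) ->
  nth bar (code w s) eo = Over c -> nth bar (code w s) eu = Under c ->
  sgn w s c = (if sg then 1 else -1)%R ->
  crossing_factor w c (labeling_of s (expand w s l)) =
  toF (strand_coeff sg (nth 0 l eo) (nth 0 l (eo.+1 %% size (code w s)))
                       (nth 0 l eu) (nth 0 l (eu.+1 %% size (code w s)))).
Proof.
move=> cw hs hl lo lu no nu hsg.
have [lc ho po] := event_slice cw hs lo no.
have [_ hu pu] := event_slice cw hs lu nu.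
have [<- <-] := event_labels cw hs hl lo.
have [<- <-] := event_labels cw hs hl lu.
have hlab : labeled (labeling_of s (expand w s l)).
  by apply: labeled_labeling_of; apply: expand_valid => //; lia.
apply: crossing_factor_strands => //.
by move: hsg; rewrite /sgn (direction_at_event cw hs lo no) (direction_at_event cw hs lu nu).
Qed.

Lemma crossing_in_code w s k o i : closes_up w -> traversal w s -> k < size w ->
  slice_at w k = (Cross o, i) -> exists b, Some (b, k) \in code w s.
Proof.
move=> cw hs lk es; have [le _] := width_slice cw lk; rewrite es /= in le.
have hx : enters w k (true, (k, i)) by rewrite /enters /= addn0 eqxx /=; lia.
have px : exists b, passages w (true, (k, i)) = [:: Some (b, k)].
  rewrite (passages_enters hx) es /involved /=.
  have -> : i <= i < i + 2 by lia.
  by rewrite eqxx; case: ifP => _; eexists.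
have [b pb] := px; exists b.
have [j lj h] := enters_traversed cw hs lk hx.
have pj : passages w (state_at s j) = [:: Some (b, k)].
  by case: h => [<-|[_ [_ _ <-]]].
by have [lt <-] := nth_code_before lj pj; rewrite mem_nth.
Qed.

(** A traversal covers all points, so every classical crossing appears in the code; slices outside
    [cs] contribute the factor 1. *)
Lemma prod_crossing_factor w s f (cs : seq nat) : closes_up w -> traversal w s ->
  uniq cs -> {in cs, forall c, c < size w} ->
  all (fun a => if a is Some (_, c) then c \in cs else true) (code w s) ->
  (\prod_(0 <= k < size w) crossing_factor w k f =
   \prod_(c <- cs) crossing_factor w c f)%R.
Proof.
move=> cw hs ucs lcs /allP hc.
transitivity (\prod_(k <- index_iota 0 (size w) | k \in cs) crossing_factor w k f)%R.
  rewrite [RHS]big_mkcond big_nat [RHS]big_nat; apply: eq_bigr => k /andP[_ lk].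
  case: ifP => // /negbT; rewrite /crossing_factor.
  case es : (slice_at w k) => [[||o||] i] //.
  by have [b /hc ->] := crossing_in_code cw hs lk es.
rewrite -big_filter; apply: perm_big; apply: uniq_perm => //.
  by rewrite filter_uniq ?iota_uniq.
move=> k; rewrite mem_filter mem_index_iota /= andbC.
by case: (boolP (k \in cs)) => [/lcs ->|]; rewrite ?andbF.
Qed.

(** * Evaluation *)

Definition sum_over (F : nat -> N) : N :=
  foldr (fun a n => N.modulo (F a + n) 11) 0%num labels.

Lemma toF_sum_over F : toF (sum_over F) = (\sum_(a <- labels) toF (F a))%R.
Proof.
rewrite /sum_over; elim: labels => [|a r IH]; first by rewrite big_nil.
by rewrite big_cons /= toF_mod toFD IH.
Qed.

(** The second factor is a thunk so that, under call by value, an inner sum is evaluated only when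
    the weight in front of it is nonzero. *)
Definition mul_lazy (a : N) (b : unit -> N) : N :=
  if a is 0%num then 0%num else (a * b tt)%num.

Lemma toF_mul_lazy a b : toF (mul_lazy a b) = (toF a * toF (b tt))%R.
Proof. by case: a => [|a]; [rewrite /= toF0 mul0r | rewrite /mul_lazy toFM]. Qed.

(** Passage [e] joins arc [e] to the next arc modulo 9. The over and under passages are numbers 5
    and 1 for c_1, 7 and 4 for c_2, and 8 and 2 for c_3. *)
Definition knot_term (l : seq nat) : 'F_11 :=
  let x i := nth 0 l i in
  (toF (strand_coeff true (x 5) (x 6) (x 1) (x 2)) *
   (toF (strand_coeff true (x 7) (x 8) (x 4) (x 5)) *
    toF (strand_coeff false (x 8) (x 0) (x 2) (x 3))))%R.

(** The bars at positions 0, 3 and 6 determine labels 1, 4 and 7, leaving six free labels. The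
    weight of c_1 is tested before the sum over [l8]. *)
Definition knot_sum : N :=
  sum_over (fun l0 => sum_over (fun l2 => sum_over (fun l3 =>
  sum_over (fun l5 => sum_over (fun l6 =>
    mul_lazy (strand_coeff true l5 l6 (dual l0) l2) (fun _ =>
    sum_over (fun l8 =>
      mul_lazy (strand_coeff true (dual l6) l8 (dual l3) l5) (fun _ =>
        strand_coeff false l8 l0 l2 l3)))))))).

Lemma knot_sum_value : knot_sum = 5%num.
Proof. by vm_compute. Qed.

Lemma sum_dual (a : nat) (F : nat -> 'F_11) : a < 8 ->
  (\sum_(b <- labels) (if b == dual a then F b else 0) = F (dual a))%R.
Proof.
move=> ha; rewrite -big_mkcond -big_filter filter_pred1_uniq ?big_seq1 ?iota_uniq //.
by rewrite mem_iota dual_lt.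
Qed.

Lemma knot_sumE :
  (\sum_(l <- all_seqs 9 | [&& nth 0 l 1 == dual (nth 0 l 0),
      nth 0 l 4 == dual (nth 0 l 3) & nth 0 l 7 == dual (nth 0 l 6)]) knot_term l
   = toF knot_sum)%R.
Proof.
rewrite big_mkcond /= sum_all_seqsS toF_sum_over big_seq [RHS]big_seq.
have lt a : a \in labels -> a < 8 by rewrite mem_iota.
apply: eq_bigr => l0 /lt h0.
rewrite sum_all_seqsS.
(* The bar at position 0 leaves only [l1 = dual l0]; [l4] and [l7] are eliminated in the same way
   below. *)
under eq_bigr => l1 _.
  rewrite (_ : (\sum_(t <- all_seqs 7) _ = if l1 == dual l0 then
    \sum_(t <- all_seqs 7)
     (if (nth 0 t 2 == dual (nth 0 t 1)) && (nth 0 t 5 == dual (nth 0 t 4))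
      then knot_term [:: l0, l1 & t] else 0) else 0)%R); last first.
    by rewrite /=; case: ifP => _ //=; rewrite big1.
  over.
rewrite /= sum_dual // sum_all_seqsS toF_sum_over; apply: eq_bigr => l2 _.
rewrite sum_all_seqsS toF_sum_over big_seq [RHS]big_seq; apply: eq_bigr => l3 /lt h3.
rewrite sum_all_seqsS.
under eq_bigr => l4 _.
  rewrite (_ : (\sum_(t <- all_seqs 4) _ = if l4 == dual l3 then
    \sum_(t <- all_seqs 4)
     (if (nth 0 t 2 == dual (nth 0 t 1))
      then knot_term [:: l0, dual l0, l2, l3, l4 & t] else 0) else 0)%R); last first.
    by rewrite /=; case: ifP => _ //=; rewrite big1.
  over.
rewrite /= sum_dual // sum_all_seqsS toF_sum_over; apply: eq_bigr => l5 _.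
rewrite sum_all_seqsS toF_sum_over big_seq [RHS]big_seq; apply: eq_bigr => l6 /lt h6.
rewrite sum_all_seqsS.
under eq_bigr => l7 _.
  rewrite (_ : (\sum_(t <- all_seqs 1) _ = if l7 == dual l6 then
    \sum_(t <- all_seqs 1)
      knot_term [:: l0, dual l0, l2, l3, dual l3, l5, l6, l7 & t] else 0)%R); last first.
    by rewrite /=; case: ifP => _ //=; rewrite big1.
  over.
rewrite /= sum_dual // sum_all_seqsS toF_mul_lazy toF_sum_over mulr_sumr.
apply: eq_bigr => l8 _.
by rewrite big_seq1 toF_mul_lazy /knot_term.
Qed.

Lemma ev_knot w s c1 c2 c3 : closes_up w -> traversal w s ->
  code w s = [:: bar; Under c1; Under c3; bar; Under c2; Over c1; bar; Over c2;
                 Over c3] ->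
  sgn w s c1 = 1%R -> sgn w s c2 = 1%R -> sgn w s c3 = (-1)%R ->
  ev w [::] = toF 5.
Proof.
move=> cw hs hc h1 h2 h3.
have E : size (code w s) = 9 by rewrite hc.
have lt e : e < 9 -> e < size (code w s) by rewrite E.
have n12 : c1 != c2.
  (* The signs of c_1 and c_2 agree, so these are told apart by their over passages at positions 5
     and 7; c_3 differs from both by its sign. *)
  apply/eqP => e; suff : 5 = 7 by [].
  by apply: (code_uniq cw hs (lt 5 isT) (lt 7 isT)); rewrite hc /= -?e.
have n13 : c1 != c3 by apply/eqP => e; move: h3; rewrite -e h1.
have n23 : c2 != c3 by apply/eqP => e; move: h3; rewrite -e h2.
rewrite (ev_code cw hs) ?E // -knot_sum_value -knot_sumE.
rewrite big_seq_cond [RHS]big_seq_cond.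
apply: eq_big => [l|l /andP[hl _]].
  by rewrite /bars_turn hc /= andbT.
rewrite -E in hl.
rewrite (prod_crossing_factor (cs := [:: c1; c2; c3]) _ cw hs).
- rewrite !big_cons big_nil mulr1.
  rewrite (event_crossing_factor (eo := 5) (eu := 1) (sg := true) cw hs hl) ?hc //.
  rewrite (event_crossing_factor (eo := 7) (eu := 4) (sg := true) cw hs hl) ?hc //.
  by rewrite (event_crossing_factor (eo := 8) (eu := 2) (sg := false) cw hs hl) ?hc.
- by rewrite /= !inE negb_or n12 n13 n23.
- have l1 := event_slice cw hs (lt 5 isT); have l2 := event_slice cw hs (lt 7 isT).
  have l3 := event_slice cw hs (lt 8 isT); rewrite hc /= in l1 l2 l3.
  move=> c; rewrite !inE => /or3P[] /eqP ->.
  + by have [] := l1 _ _ erefl.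
  + by have [] := l2 _ _ erefl.
  + by have [] := l3 _ _ erefl.
- by rewrite hc /= !inE !eqxx ?orbT.
Qed.

Theorem mainTheorem2 (D : diagram) (s : seq state) (c1 c2 c3 : nat)
  (hs : traversal (slices D) s)
  (hcode : code (slices D) s =
     [:: bar; Under c1; Under c3; bar; Under c2; Over c1; bar; Over c2; Over c3])
  (h1 : sgn (slices D) s c1 = 1%R)
  (h2 : sgn (slices D) s c2 = 1%R)
  (h3 : sgn (slices D) s c3 = (-1)%R) :
  ~ equivalent D trivial_nonorientable_curve.
Proof.
move=> /equivalent_invariant; rewrite invariant_trivial /invariant.
rewrite (ev_knot (svalP D) hs hcode h1 h2 h3).
by move/eqP; vm_compute.
Qed.
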